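(* Let $L\ge 2$ and $d\ge 1$ be integers, and let $x_0,\dots,x_{L-1}\in\mathbb{R}^d$ be pairwise distinct templates, all having the same Euclidean norm. Let $n_0,\dots,n_{M-1}$ be i.i.d. $\mathcal{N}(0,I_{d\times d})$ random vectors, and let $\hat{x}_0,\dots,\hat{x}_{L-1}$ denote the output of either the hard-assignment algorithm or the soft-assignment algorithm (both defined in the context) applied to these templates and observations. 1. (Non-vanishing estimators.) For every $0\le \ell\le L-1$, $\lim_{M\to\infty}\hat{x}_\ell\neq 0$ almost surely. 2. (Positive correlation.) For every $0\le \ell\le L-1$, $\lim_{M\to\infty}\mathbb{E}[\langle \hat{x}_\ell,x_\ell\rangle]>0$. 3. (Consistency, hard-assignment only.) If $\hat{x}_0,\dots,\hat{x}_{L-1}$ is the output of the hard-assignment algorithm, then for every $\ell$ and every $k\neq \ell$, $\lim_{M\to\infty}\mathbb{E}[\langle \hat{x}_\ell,x_\ell\rangle]>\lim_{M\to\infty}\mathbb{E}[\langle \hat{x}_\ell,x_k\rangle]$.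
   Context: Hard-assignment algorithm: for each $i=0,\dots,M-1$ let $\hat{R}_i=\arg\max_{0\le \ell\le L-1}\langle n_i,x_\ell\rangle$ (almost surely unique), let $\mathcal{A}_\ell=\{n_i:\hat{R}_i=\ell\}$, and set $\hat{x}_\ell=\frac{1}{|\mathcal{A}_\ell|}\sum_{n_i\in\mathcal{A}_\ell}n_i$. Soft-assignment algorithm (one EM iteration): set $p_i^{(\ell)}=\frac{\exp(\langle n_i,x_\ell\rangle)}{\sum_{r=0}^{L-1}\exp(\langle n_i,x_r\rangle)}$ and $\hat{x}_\ell=\frac{\sum_{i=0}^{M-1}p_i^{(\ell)}n_i}{\sum_{i=0}^{M-1}p_i^{(\ell)}}$. *)

(* Defs.v *)
From HB Require Import structures.
From mathcomp Require Import all_boot all_order all_algebra.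
From mathcomp Require Import all_classical all_reals all_analysis.
Set Implicit Arguments. Unset Strict Implicit. Unset Printing Implicit Defensive.
Import Order.TTheory GRing.Theory Num.Theory.
Import numFieldNormedType.Exports.
Local Open Scope classical_set_scope.
Local Open Scope ring_scope.

Section Defs.
Context {R : realType}.

Definition dotv (d : nat) (u v : 'rV[R]_d) : R := \sum_(j < d) u 0 j * v 0 j.
Definition enorm (d : nat) (u : 'rV[R]_d) : R := Num.sqrt (dotv u u).

(* Hard-assignment estimator from the first M observations nn 0, ..., nn (M-1):
   observation i is assigned to cluster l when l maximizes <nn i, x_r> over r
   (the maximizer is a.s. unique). Empty cluster gives 0 (0^-1 = 0). *)
Definition hard_est (L d : nat) (x : 'I_L -> 'rV[R]_d) (M : nat)
    (nn : nat -> 'rV[R]_d) (l : 'I_L) : 'rV[R]_d :=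
  let A := [seq i <- iota 0 M |
             [forall r : 'I_L, dotv (nn i) (x r) <= dotv (nn i) (x l)]] in
  (size A)%:R^-1 *: \sum_(i <- A) nn i.

Definition soft_weight (L d : nat) (x : 'I_L -> 'rV[R]_d) (v : 'rV[R]_d)
    (l : 'I_L) : R :=
  expR (dotv v (x l)) / \sum_(r < L) expR (dotv v (x r)).

Definition soft_est (L d : nat) (x : 'I_L -> 'rV[R]_d) (M : nat)
    (nn : nat -> 'rV[R]_d) (l : 'I_L) : 'rV[R]_d :=
  (\sum_(i < M) soft_weight x (nn i) l)^-1 *:
    \sum_(i < M) soft_weight x (nn i) l *: nn i.

Definition mutually_independent (dT : measure_display) (T : measurableType dT)
    (P : probability T R) (I : eqType) (X : I -> T -> R) : Prop :=
  forall (s : seq I) (B : I -> set R), uniq s ->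
    (forall i, i \in s -> measurable (B i)) ->
    P (\big[setI/setT]_(i <- s) (X i @^-1` B i)) =
    (\prod_(i <- s) P (X i @^-1` B i))%E.

End Defs.

(* Main.v *)
Require Import Defs.
From HB Require Import structures.
From mathcomp Require Import all_boot all_order all_algebra.
From mathcomp Require Import all_classical all_reals all_analysis.
From mathcomp Require Import measurable_realfun.
From mathcomp Require Import zify ring lra.
Import Order.TTheory GRing.Theory Num.Theory.
Import numFieldNormedType.Exports.
Local Open Scope classical_set_scope.
Local Open Scope ring_scope.

(* Both estimators are weighted means (sum_i f(n_i))^-1 sum_i f(n_i) n_i for a
   measurable weight f with values in [0, 1]: the indicator of the cell
   S = {v | <v, x_l> is maximal} or the softmax weight.  The strong law of large
   numbers gives the almost sure limit E[f(N) N] / E[f(N)], and second and fourth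
   moment bounds show that the convergence also holds in mean, with error
   O(1/sqrt M).  It remains to see that E[f(N) <N, x_l>] > 0.

   By Cameron-Martin, E[f(N - t y)] e^(t^2 |y|^2 / 2) = E[f(N) e^(-t <N, y>)], and
   e^u >= 1 + u shows that if t |-> E[f(N - t y)] decreases at rate at least c
   near 0+, then E[f(N) <N, y>] >= c.  The softmax weight decreases at a positive
   rate along - x_l.  The indicator of S is monotone along every direction of the
   cone S itself, so E[f(N) <N, z>] >= 0 for z in S; since
   E[f(N) <N, x_l - x_k>] > 0 and K x_l - (x_l - x_k) lies in S for large K, the
   inequality in the direction x_l is strict. *)

(** * Borel structure on row vectors and laws *)

(** Two obstacles shape the argument. The cell indicator is not differentiable, so Gaussian
    integration by parts is replaced by a one-sided comparison of shifted expectations, which only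
    asks how the weight varies along one direction. The total weight in the denominator may be
    arbitrarily small, or zero for an empty cluster, so the almost sure limit alone does not give
    the limit of expectations; a weighted mean is however bounded by the largest [|g i|], and fourth
    moments control that. Equal norms and distinctness enter through [<x_l, x_r> < |x_l|^2] for
    [r != l]: each [x_l] is interior to its own cell. Hence every point enters the cell after a
    large shift along [x_l], and as shifted Gaussian laws have the same null sets, the cell has
    positive mass. The same interior position lets [K x_l] absorb [x_l - x_k]. Monotonicity along
    [x_l] itself would only give [>= 0]; removing [x_l - x_k], whose correlation is already known to
    be positive, produces the strict sign. *)

Definition row_display : measure_display. Proof. exact. Qed.

Section measurable_row.
Context {R : realType} {d : nat}.
Let coord (j : 'I_d) (v : 'rV[R]_d) : R := v 0 j.

(** Generating by coordinates makes measurability into rows a coordinatewise matter and lets boxes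
    determine laws, which is the form in which independence is assumed. *)
HB.instance Definition _ := @isMeasurable.Build row_display 'rV[R]_d
  (g_sigma_preimage coord) (@sigma_algebra0 _ _ _) (@sigma_algebraC _ _)
  (@sigma_algebra_bigcup _ _ _).

Lemma measurable_coord (j : 'I_d) :
  measurable_fun [set: 'rV[R]_d] (fun v : 'rV[R]_d => v 0 j).
Proof.
move=> _ Y mY; rewrite setTI; apply: sub_sigma_algebra => /=.
rewrite -bigcup_seq/=; exists j => /=; first by rewrite mem_index_enum.
by exists Y => //; rewrite setTI.
Qed.

Lemma measurable_row_fun d' (T : measurableType d') (f : T -> 'rV[R]_d) :
  (forall j, measurable_fun setT (fun w => f w 0 j)) -> measurable_fun setT f.
Proof.
move=> mf; refine (@measurability _ _ T 'rV[R]_d setT f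
  (\big[setU/set0]_(i < d) preimage_set_system setT (coord i) measurable) erefl _).
move=> _ [B + <-]; rewrite -bigcup_seq => -[j _ [C mC <-]].
rewrite setTI; have := mf j measurableT C mC; rewrite !setTI; exact.
Qed.

Definition box (B : 'I_d -> set R) : set 'rV[R]_d :=
  [set v | forall j, B j (v 0 j)].

Lemma measurable_box (B : 'I_d -> set R) :
  (forall j, measurable (B j)) -> measurable (box B).
Proof.
move=> mB; have -> : box B = \big[setI/setT]_(j < d) (coord j @^-1` B j).
  rewrite -bigcap_seq; apply/seteqP; split => [v Bv j _|v Bv j]; first exact: Bv.
  by apply: Bv; rewrite /= mem_index_enum.
apply: bigsetI_measurable => j _; rewrite -[X in measurable X]setTI.
exact: measurable_coord.
Qed.

(** Boxes form a generating pi-system that contains the whole space, so finiteness of [m1 setT] lets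
    a constant sequence serve as the exhaustion. *)
Lemma row_measure_unique (m1 m2 : {measure set 'rV[R]_d -> \bar R}) :
  (m1 setT < +oo)%E ->
  (forall B, (forall j, measurable (B j)) -> m1 (box B) = m2 (box B)) ->
  forall A, measurable A -> m1 A = m2 A.
Proof.
move=> m1oo m12 A mA.
have boxT : box (fun=> setT) = setT by apply/seteqP; split.
apply: (@measure_unique _ _ _
  [set C | exists2 B, (forall j, measurable (B j)) & C = box B]
  (fun=> setT)) => //.
- apply/seteqP; split.
  + apply: smallest_sub; first exact: smallest_sigma_algebra.
    move=> C; rewrite -bigcup_seq => -[j _ [D mD <-]].
    apply: sub_sigma_algebra; exists (fun k => if k == j then D else setT).
      by move=> k; case: ifP.
    apply/seteqP; split => [v [_ Dv] k|v /(_ j)]; last by rewrite eqxx setTI.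
    by have [->|] := eqVneq k j.
  + apply: smallest_sub; first exact: sigma_algebra_measurable.
    by move=> _ [B mB ->]; exact: measurable_box.
- move=> _ _ [B mB ->] [C mC ->]; exists (fun j => B j `&` C j).
    by move=> j; exact: measurableI.
  apply/seteqP; split => [v [Bv Cv] j|v BCv]; first by split.
  by split=> j; have [] := BCv j.
- by move=> _; exists (fun=> setT).
- by rewrite bigcup_const.
- by move=> _ [B mB ->]; exact: m12.
Qed.

End measurable_row.

(** * Integration against laws, densities and product laws *)

Section law.
Context {R : realType}.

(** Both sides are integrals against the common pushforward. The source spaces may differ, which
    later allows a coordinate to be resampled on a product space. *)
Lemma eq_law_integral d1 d2 d3 (T1 : measurableType d1) (T2 : measurableType d2)
  (V : measurableType d3) (m1 : {measure set T1 -> \bar R})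
  (m2 : {measure set T2 -> \bar R}) (X : T1 -> V) (Y : T2 -> V) (f : V -> \bar R) :
  measurable_fun setT X -> measurable_fun setT Y ->
  (forall A, measurable A -> m1 (X @^-1` A) = m2 (Y @^-1` A)) ->
  measurable_fun setT f -> (forall v, 0 <= f v)%E ->
  (\int[m1]_w f (X w) = \int[m2]_w f (Y w))%E.
Proof.
move=> mX mY XY mf f0.
transitivity (\int[pushforward m1 X]_v f v)%E.
  by rewrite ge0_integral_pushforward// preimage_setT.
transitivity (\int[pushforward m2 Y]_v f v)%E; last first.
  by rewrite ge0_integral_pushforward// preimage_setT.
by apply: eq_measure_integral => A mA _; exact: XY.
Qed.

Lemma eq_law_integral_signed d1 d2 d3 (T1 : measurableType d1) (T2 : measurableType d2)
  (V : measurableType d3) (m1 : {measure set T1 -> \bar R})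
  (m2 : {measure set T2 -> \bar R}) (X : T1 -> V) (Y : T2 -> V) (f : V -> \bar R) :
  measurable_fun setT X -> measurable_fun setT Y ->
  (forall A, measurable A -> m1 (X @^-1` A) = m2 (Y @^-1` A)) ->
  measurable_fun setT f ->
  (\int[m1]_w f (X w) = \int[m2]_w f (Y w))%E.
Proof.
move=> mX mY XY mf; rewrite [LHS]integralE [RHS]integralE.
congr (_ - _)%E.
- transitivity (\int[m1]_w f^\+%E (X w))%E.
    by apply: eq_integral => w _; rewrite !funeposE.
  rewrite (eq_law_integral _ _ _ _ _ _ _ _ _ _ f^\+%E mX mY XY)//.
    by apply: eq_integral => w _; rewrite !funeposE.
  exact: measurable_funepos.
- transitivity (\int[m1]_w f^\-%E (X w))%E.
    by apply: eq_integral => w _; rewrite !funenegE.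
  rewrite (eq_law_integral _ _ _ _ _ _ _ _ _ _ f^\-%E mX mY XY)//.
    by apply: eq_integral => w _; rewrite !funenegE.
  exact: measurable_funeneg.
Qed.

Lemma eq_law_integrable d1 d2 d3 (T1 : measurableType d1) (T2 : measurableType d2)
  (V : measurableType d3) (m1 : {measure set T1 -> \bar R})
  (m2 : {measure set T2 -> \bar R}) (X : T1 -> V) (Y : T2 -> V) (f : V -> \bar R) :
  measurable_fun setT X -> measurable_fun setT Y ->
  (forall A, measurable A -> m1 (X @^-1` A) = m2 (Y @^-1` A)) ->
  measurable_fun setT f ->
  m1.-integrable setT (fun w => f (X w)) -> m2.-integrable setT (fun w => f (Y w)).
Proof.
move=> mX mY XY mf /integrableP[_ fX]; apply/integrableP; split.
  exact: measurableT_comp.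
rewrite -(eq_law_integral _ _ _ _ _ _ _ _ _ _ (fun v => `|f v|)%E mX mY XY) //.
exact: measurableT_comp.
Qed.

End law.

Section density.
Context {R : realType}.
Import HBNNSimple.

(** The usual ascent from indicators to simple functions to monotone limits. *)
Lemma ge0_integral_density d1 (V : measurableType d1)
  (mu nu : {measure set V -> \bar R}) (p : V -> R) (f : V -> \bar R) :
  measurable_fun setT p -> (forall x, 0 <= p x) ->
  (forall A, measurable A -> nu A = \int[mu]_(x in A) (p x)%:E)%E ->
  measurable_fun setT f -> (forall x, 0 <= f x)%E ->
  (\int[nu]_x f x = \int[mu]_x (f x * (p x)%:E))%E.
Proof.
move=> mp p0 nuE mf f0.
have nuind A : measurable A ->
    (\int[nu]_x (\1_A x)%:E = \int[mu]_x ((\1_A x)%:E * (p x)%:E))%E.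
  move=> mA; rewrite integral_indic// setIT nuE// integral_mkcond.
  apply: eq_integral => x _; rewrite patchE indicE.
  by case: ifPn => xA; rewrite ?mul1e ?mul0e.
have nusf (g : {nnsfun V >-> R}) :
    (\int[nu]_x (g x)%:E = \int[mu]_x ((g x)%:E * (p x)%:E))%E.
  under eq_integral do rewrite fimfunE -fsumEFin//.
  rewrite ge0_integral_fsum//; last 2 first.
    by move=> r; exact/measurable_EFinP/measurableT_comp.
    by move=> r x _; rewrite EFinM nnfun_muleindic_ge0.
  under [RHS]eq_integral.
    move=> x _; rewrite fimfunE -fsumEFin// ge0_mule_fsuml; last first.
      by move=> r; rewrite EFinM nnfun_muleindic_ge0.
    over.
  rewrite [RHS]ge0_integral_fsum//; last 2 first.
    - move=> r; apply: emeasurable_funM; last exact/measurable_EFinP.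
      exact/measurable_EFinP/measurableT_comp.
    - by move=> r x _; rewrite EFinM mule_ge0 ?nnfun_muleindic_ge0// lee_fin.
  apply: eq_fsbigr => r rg.
  have r0 : 0 <= r by move: rg; rewrite inE => -[x _ <-].
  under [LHS]eq_integral do rewrite EFinM.
  under [RHS]eq_integral do rewrite EFinM -muleA.
  rewrite !ge0_integralZl//; first by rewrite nuind.
  - apply: emeasurable_funM; last exact/measurable_EFinP.
    exact/measurable_EFinP/measurable_indic.
  - by move=> x _; rewrite mule_ge0 ?lee_fin.
  - exact/measurable_EFinP/measurable_indic.
pose f_ := nnsfun_approx measurableT mf.
have f_cvg x : (EFin \o (fun n => f_ n x)) n @[n --> \oo] --> f x.
  exact: (cvg_nnsfun_approx measurableT mf (fun x _ => f0 x)).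
transitivity (limn (fun n => \int[nu]_x (f_ n x)%:E)%E).
  rewrite -monotone_convergence//.
  - by apply: eq_integral => x _; apply/esym/cvg_lim => //; exact: f_cvg.
  - by move=> n; exact/measurable_EFinP.
  - by move=> n x _; rewrite lee_fin.
  - by move=> x _ m n mn; rewrite lee_fin; exact/lefP/nd_nnsfun_approx.
under eq_fun do rewrite nusf.
rewrite -monotone_convergence//.
- apply: eq_integral => x _; apply/cvg_lim => //.
  by apply: cvgeZr => //; exact: f_cvg.
- by move=> n; apply: emeasurable_funM; exact/measurable_EFinP.
- by move=> n x _; rewrite mule_ge0 ?lee_fin.
- move=> x _ m n mn; rewrite lee_wpmul2r ?lee_fin//.
  exact/lefP/nd_nnsfun_approx.
Qed.

End density.

Section product_law.
Context {R : realType}.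

Lemma indep_law_prod d1 d2 d3 (T : measurableType d1) (V : measurableType d2)
  (W : measurableType d3) (P : probability T R) (Q1 : probability V R) (Q2 : probability W R)
  (X : T -> V * W) :
  measurable_fun setT X ->
  (forall A B, measurable A -> measurable B ->
    P (X @^-1` (A `*` B)) = (Q1 A * Q2 B)%E) ->
  forall A, measurable A -> P (X @^-1` A) = (Q1 \x Q2)%E A.
Proof.
move=> mX XE A mA; apply/esym.
unshelve refine (@product_measure_unique _ _ _ _ _ Q1 Q2 (pushforward P X) _ A mA);
  exact: mX || exact: XE.
Qed.

End product_law.

(** * Gaussian shifts and the scalar product *)

Section gaussian1.
Context {R : realType}.
Local Notation mu := (@lebesgue_measure R).

Lemma ge0_integral_lebesgue_shift (f : R -> \bar R) (c : R) :
  measurable_fun setT f -> (forall x, 0 <= f x)%E ->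
  (\int[mu]_x f (x + c)%R = \int[mu]_x f x)%E.
Proof.
move=> mf f0.
have mD : measurable_fun [set: measurableTypeR R] (fun x : measurableTypeR R => x + c).
  exact: measurable_funD.
(* Lebesgue measure is characterized by its values on half-open intervals, and translation preserves
   their length. *)
have muE (B : set (measurableTypeR R)) : measurable B ->
    mu B = pushforward mu (fun x : measurableTypeR R => x + c) B.
  move=> mB; unshelve refine (@lebesgue_measure_unique R (pushforward mu _) _ B mB);
    first exact: mD.
  move=> _ [[a b] _ <-].
  transitivity (mu `](a - c), (b - c)]%classic).
    by rewrite !lebesgue_measure_itv/= !lte_fin ltrD2r; case: ifP => // _;
      rewrite -!EFinD; congr _%:E; ring.
  congr (mu _); apply/seteqP; split => x /=; rewrite !in_itv/= ltrBlDr lerBrDr//.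
exact: (@eq_law_integral R _ _ _ (measurableTypeR R) (measurableTypeR R)
  (measurableTypeR R) mu mu (fun x => x + c) idfun f mD (@measurable_id _ _ _)
  (fun A mA => esym (muE A mA)) mf f0).
Qed.

Local Notation N01 := (@normal_prob R 0 1).

(** Cameron-Martin in dimension one. Once the right side is translated by [c], the two densities
    agree because [- (x + c)^2 / 2 + c (x + c) = - x^2 / 2 + c^2 / 2]. Nonnegativity of [f] avoids
    any integrability condition. *)
Lemma ge0_integral_normal_shift (f : R -> \bar R) (c : R) :
  measurable_fun setT f -> (forall x, 0 <= f x)%E ->
  (\int[N01]_x (f (x + c)%R * (expR (c ^+ 2 / 2))%:E) =
   \int[N01]_x (f x * (expR (c * x))%:E))%E.
Proof.
move=> mf f0.
have dens (g : R -> \bar R) : measurable_fun setT g -> (forall x, 0 <= g x)%E ->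
    (\int[N01]_x g x = \int[mu]_x (g x * (normal_pdf 0 1 x)%:E))%E.
  move=> mg g0; apply: ge0_integral_density => //.
    exact: measurable_normal_pdf.
  exact: normal_pdf_ge0.
have mshift : measurable_fun setT (fun x : R => f (x + c)).
  apply: (measurableT_comp mf); exact: measurable_funD.
have mexp : measurable_fun setT (fun x : R => (expR (c * x))%:E).
  by apply/measurable_EFinP; apply: measurableT_comp => //; exact: measurable_funM.
rewrite dens; last 2 first.
- by apply: emeasurable_funM.
- by move=> x; rewrite mule_ge0// lee_fin expR_ge0.
rewrite dens; last 2 first.
- by apply: emeasurable_funM.
- by move=> x; rewrite mule_ge0// lee_fin expR_ge0.
rewrite -[RHS](ge0_integral_lebesgue_shift _ c).
- apply: eq_integral => x _.
  rewrite -!muleA -!EFinM; congr (_ * _%:E)%E.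
  rewrite !normal_pdfE ?oner_eq0// /normal_fun mulrCA [RHS]mulrCA -!expRD.
  by congr (_ * expR _); field.
- apply: emeasurable_funM; first by apply: emeasurable_funM.
  by apply/measurable_EFinP; exact: measurable_normal_pdf.
- by move=> x; rewrite !mule_ge0// lee_fin ?expR_ge0 ?normal_pdf_ge0.
Qed.

End gaussian1.

Section dotv_theory.
Context {R : realType} {d : nat}.
Implicit Types u v w : 'rV[R]_d.

Lemma dotvC u v : dotv u v = dotv v u.
Proof. by apply: eq_bigr => j _; rewrite mulrC. Qed.

Lemma dotvDl u v w : dotv (u + v) w = dotv u w + dotv v w.
Proof. by rewrite -big_split; apply: eq_bigr => j _; rewrite mxE mulrDl. Qed.

Lemma dotvZl a u v : dotv (a *: u) v = a * dotv u v.
Proof. by rewrite mulr_sumr; apply: eq_bigr => j _; rewrite mxE mulrA. Qed.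

Lemma dotvDr u v w : dotv u (v + w) = dotv u v + dotv u w.
Proof. by rewrite dotvC dotvDl !(dotvC u). Qed.

Lemma dotvZr a u v : dotv u (a *: v) = a * dotv u v.
Proof. by rewrite dotvC dotvZl dotvC. Qed.

Lemma dotvNr u v : dotv u (- v) = - dotv u v.
Proof. by rewrite -scaleN1r dotvZr mulN1r. Qed.

Lemma dotvBr u v w : dotv u (v - w) = dotv u v - dotv u w.
Proof. by rewrite dotvDr dotvNr. Qed.

Lemma dotvNl u v : dotv (- u) v = - dotv u v.
Proof. by rewrite dotvC dotvNr dotvC. Qed.

Lemma dotvBl u v w : dotv (u - v) w = dotv u w - dotv v w.
Proof. by rewrite dotvDl dotvNl. Qed.

Lemma dotv0l v : dotv 0 v = 0.
Proof. by rewrite -(scale0r 0) dotvZl mul0r. Qed.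

Lemma dotv_suml (I : Type) (s : seq I) (F : I -> 'rV[R]_d) v :
  dotv (\sum_(i <- s) F i) v = \sum_(i <- s) dotv (F i) v.
Proof.
by apply: (big_morph (fun u => dotv u v)) => [u w|]; rewrite ?dotvDl ?dotv0l.
Qed.

Lemma dotv_delta u j : dotv u (delta_mx 0 j) = u 0 j.
Proof.
rewrite /dotv (bigD1 j)//= mxE !eqxx mulr1 big1 ?addr0// => k kj.
by rewrite mxE (negbTE kj) andbF mulr0.
Qed.

Lemma dotv_ge0 u : 0 <= dotv u u.
Proof. by apply: sumr_ge0 => j _; rewrite -expr2 sqr_ge0. Qed.

Lemma dotv_eq0 u : (dotv u u == 0) = (u == 0).
Proof.
apply/eqP/eqP => [uu0|->]; last exact: dotv0l.
have /psumr_eq0P u0 : forall j : 'I_d, true -> 0 <= u 0 j * u 0 j.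
  by move=> j _; rewrite -expr2 sqr_ge0.
apply/rowP => j; rewrite mxE; apply/eqP.
by rewrite -(sqrf_eq0 (u 0 j)) expr2; apply/eqP/u0.
Qed.

Lemma measurable_dotv d' (T : measurableType d') (f : T -> 'rV[R]_d) v :
  measurable_fun setT f -> measurable_fun setT (fun w : T => dotv (f w) v).
Proof.
move=> mf; apply: measurable_sum => j; apply: measurable_funM => //.
exact: (measurableT_comp (measurable_coord j)).
Qed.

Lemma measurable_shift v : measurable_fun setT (fun u : 'rV[R]_d => u + v).
Proof.
apply: measurable_row_fun => j; under eq_fun do rewrite mxE.
by apply: measurable_funD => //; exact: measurable_coord.
Qed.

End dotv_theory.

(** * A strong law of large numbers for uncorrelated variables *)

Section expectation_theory.
Context {R : realType} {dT : measure_display} {T : measurableType dT}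
  (P : probability T R).
Implicit Types f g : T -> R.

Definition rintegrable f := P.-integrable setT (EFin \o f).
(** Real-valued so that ring and linear arithmetic apply; it carries its usual meaning only together
    with [rintegrable]. *)
Definition mean f : R := \int[P]_w f w.

Lemma rintegrable_measurable f : rintegrable f -> measurable_fun setT f.
Proof. by move=> /integrableP[/measurable_EFinP]. Qed.

Lemma integral_mean f : rintegrable f -> (\int[P]_w (f w)%:E = (mean f)%:E)%E.
Proof. by move=> If; rewrite /mean /Rintegral fineK//; exact: integrable_fin_num. Qed.

Lemma rintegrable_cst (c : R) : rintegrable (fun=> c).
Proof. exact: (finite_measure_integrable_cst P). Qed.

Lemma mean_cst (c : R) : mean (fun=> c) = c.
Proof.
rewrite /mean Rintegral_cst//.
transitivity (c * fine 1%E); last by rewrite mulr1.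
by congr (_ * fine _); exact: probability_setT.
Qed.

Lemma rintegrableD f g :
  rintegrable f -> rintegrable g -> rintegrable (fun w => f w + g w).
Proof. by move=> If Ig; have := integrableD measurableT If Ig. Qed.

Lemma meanD f g : rintegrable f -> rintegrable g ->
  mean (fun w => f w + g w) = mean f + mean g.
Proof. by move=> If Ig; exact: RintegralD. Qed.

Lemma rintegrableB f g :
  rintegrable f -> rintegrable g -> rintegrable (fun w => f w - g w).
Proof. by move=> If Ig; have := integrableB measurableT If Ig. Qed.

Lemma meanB f g : rintegrable f -> rintegrable g ->
  mean (fun w => f w - g w) = mean f - mean g.
Proof. by move=> If Ig; exact: RintegralB. Qed.

Lemma rintegrableZ (c : R) f : rintegrable f -> rintegrable (fun w => c * f w).
Proof. by move=> If; have := integrableZl measurableT c If. Qed.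

Lemma meanZ (c : R) f : rintegrable f -> mean (fun w => c * f w) = c * mean f.
Proof. by move=> If; exact: RintegralZl. Qed.

Lemma rintegrable_sum (I : Type) (s : seq I) (F : I -> T -> R) :
  (forall i, rintegrable (F i)) -> rintegrable (fun w => \sum_(i <- s) F i w).
Proof.
move=> IF; elim: s => [|i s IH].
  by under [fun w => _]funext do rewrite big_nil; exact: rintegrable_cst.
under [fun w => _]funext do rewrite big_cons.
exact: rintegrableD.
Qed.

Lemma mean_sum (I : Type) (s : seq I) (F : I -> T -> R) :
  (forall i, rintegrable (F i)) ->
  mean (fun w => \sum_(i <- s) F i w) = \sum_(i <- s) mean (F i).
Proof.
move=> IF; elim: s => [|i s IH].
  by under [fun w => _]funext do rewrite big_nil; rewrite mean_cst big_nil.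
under [fun w => _]funext do rewrite big_cons.
by rewrite meanD ?IH ?big_cons//; exact: rintegrable_sum.
Qed.

Lemma le_rintegrable f g : measurable_fun setT f ->
  (forall w, `|f w| <= g w) -> rintegrable g -> rintegrable f.
Proof.
move=> mf fg; apply: le_integrable => //; first exact/measurable_EFinP.
by move=> w _; rewrite /= lee_fin (le_trans (fg w))// ler_norm.
Qed.

Lemma le_mean f g : rintegrable f -> rintegrable g ->
  (forall w, f w <= g w) -> mean f <= mean g.
Proof. by move=> If Ig fg; apply: le_Rintegral. Qed.

Lemma mean_ge0 f : (forall w, 0 <= f w) -> 0 <= mean f.
Proof. by move=> f0; apply: Rintegral_ge0. Qed.

Lemma norm_mean f : rintegrable f -> `|mean f| <= mean (fun w => `|f w|).
Proof. by move=> If; apply: le_normr_Rintegral. Qed.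

Lemma rintegrable_norm f : rintegrable f -> rintegrable (fun w => `|f w|).
Proof.
move=> If; apply: (le_integrable _ _ _ If) => //.
  by apply/measurable_EFinP; apply: measurableT_comp => //; exact: rintegrable_measurable.
by move=> w _; rewrite /= normr_id.
Qed.

Lemma mean_eq0_ae f : rintegrable f -> (forall w, 0 <= f w) -> mean f = 0 ->
  {ae P, forall w, f w = 0}.
Proof.
move=> If f0 Ef0.
have : ae_eq P setT (EFin \o f) (cst 0%E).
  apply/ae_eq_integral_abs => //.
    by apply/measurable_EFinP; exact: rintegrable_measurable.
  under eq_integral do rewrite /= ger0_norm//.
  by rewrite integral_mean// Ef0.
by apply: filterS => w /(_ I) /= [].
Qed.

End expectation_theory.

(** The inverse is the real power of exponent [-1], also at 0, where both are 0; total weights that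
    vanish are thus covered. *)
Lemma measurable_inv_ge0 {R : realType} d (T : measurableType d) (f : T -> R) :
  (forall w, 0 <= f w) -> measurable_fun setT f ->
  measurable_fun setT (fun w => (f w)^-1).
Proof.
move=> f0 mf; under eq_fun do rewrite -powR_inv1//.
exact: (measurableT_comp (measurable_powR _)).
Qed.

Lemma sum_inv_sqr_le2 {R : realType} (m : nat) :
  \sum_(0 <= k < m) (k.+1%:R ^+ 2)^-1 <= 2 :> R.
Proof.
(* The strengthened bound telescopes: with [x = k + 1 >= 1], [1 / x^2 <= 2 (1 / x - 1 / (x + 1))]
   since [x + 1 <= 2 x]. *)
suff : \sum_(0 <= k < m) (k.+1%:R ^+ 2)^-1 <= 2 * (1 - m.+1%:R^-1) :> R.
  by move=> /le_trans; apply; rewrite mulrBr mulr1 lerBlDr lerDl mulr_ge0// invr_ge0.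
elim: m => [|m IH]; first by rewrite big_geq// invr1 subrr mulr0.
rewrite big_nat_recr//=; apply: (le_trans (lerD IH (lexx _))).
have -> : m.+2%:R = m.+1%:R + 1 :> R by rewrite -natr1.
set x : R := m.+1%:R; have x1 : 1 <= x by rewrite /x ler1n.
rewrite -subr_ge0.
have -> : 2 * (1 - (x + 1)^-1) - (2 * (1 - x^-1) + (x ^+ 2)^-1) =
    (x - 1) / (x ^+ 2 * (x + 1)).
  by field; apply/andP; split; lra.
by rewrite divr_ge0 ?mulr_ge0 ?exprn_ge0//; lra.
Qed.

Lemma nat_between_squares (k0 M : nat) : ((k0.+1 ^ 2) <= M)%N ->
  exists k, [/\ (k0 <= k)%N, (k.+1 ^ 2 <= M)%N & (M < k.+2 ^ 2)%N].
Proof.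
move=> k0M.
have ex : exists k, ((k.+1 ^ 2 <= M) && (k0 <= k))%N by exists k0; rewrite k0M leqnn.
have ub k : ((k.+1 ^ 2 <= M) && (k0 <= k))%N -> (k <= M)%N.
  by move=> /andP[kM _]; apply: leq_trans kM; rewrite !expnS expn0; nia.
case: (ex_maxnP ex ub) => k /andP[kM k0k] kmax; exists k; split => //.
rewrite ltnNge; apply/negP => kM'.
by have := kmax k.+1; rewrite kM' (leq_trans k0k)// ltnn => /(_ isT).
Qed.

Section slln.
Context {R : realType} {dT : measure_display} {T : measurableType dT}
  (P : probability T R) (D : nat -> T -> R) (s : R).
Hypothesis ID : forall i k, rintegrable P (fun w => D i w * D k w).
Hypothesis D2 : forall i, mean P (fun w => D i w * D i w) <= s.
Hypothesis Dorth : forall i k, i != k -> mean P (fun w => D i w * D k w) = 0.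

Let S m M w := \sum_(i <- index_iota m M) D i w.

Let S2E m M w : S m M w ^+ 2 =
  \sum_(i <- index_iota m M) \sum_(k <- index_iota m M) D i w * D k w.
Proof. by rewrite expr2 /S big_distrlr. Qed.

Lemma rintegrable_sum_sqr m M : rintegrable P (fun w => S m M w ^+ 2).
Proof.
under [fun w => _]funext do rewrite S2E.
by apply: rintegrable_sum => i; apply: rintegrable_sum => k; exact: ID.
Qed.

(** Orthogonality kills the cross terms, so only the diagonal remains. *)
Lemma mean_sum_sqr m M : mean P (fun w => S m M w ^+ 2) <= (M - m)%:R * s.
Proof.
under [fun w => _]funext do rewrite S2E.
rewrite mean_sum; last by move=> i; apply: rintegrable_sum => k; exact: ID.
have -> : (M - m)%:R * s = \sum_(i <- index_iota m M) s.
  by rewrite big_const_nat iter_addr_0 mulr_natl.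
rewrite big_seq [leRHS]big_seq; apply: ler_sum => i im.
rewrite mean_sum// (bigD1_seq i) ?iota_uniq//= big1 ?addr0//.
by move=> k ki; rewrite Dorth// eq_sym.
Qed.

Let s0 : 0 <= s.
Proof. by apply: le_trans (D2 0); apply: mean_ge0 => w; rewrite -expr2 sqr_ge0. Qed.

(* [q k] controls [S 0 M / M] for all [M] in the block [k.+1 ^ 2 <= M < k.+2 ^ 2];
   its mean is O(k^-2), hence [q k --> 0] almost surely. *)
Let q k w := (k.+1%:R ^+ 4)^-1 * (S 0 (k.+1 ^ 2) w ^+ 2 +
  \sum_(M <- index_iota (k.+1 ^ 2) (k.+2 ^ 2)) S (k.+1 ^ 2) M w ^+ 2).

Let q_ge0 k w : 0 <= q k w.
Proof.
apply: mulr_ge0; first by rewrite invr_ge0 exprn_ge0.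
by apply: addr_ge0; [exact: sqr_ge0|apply: sumr_ge0 => M _; exact: sqr_ge0].
Qed.

Let Iq k : rintegrable P (q k).
Proof.
apply: rintegrableZ; apply: rintegrableD; first exact: rintegrable_sum_sqr.
by apply: rintegrable_sum => M; exact: rintegrable_sum_sqr.
Qed.

(** With [x = k + 1], a block has [2k + 3 <= 3 x] indices, each partial sum over it having second
    moment at most [3 x s]; together with [x^2 s] for the sum up to [x^2] this makes [10 x^2 s].
    Replacing the maximum over the block by the sum costs only a factor of order [x], which the
    denominator [x^4] affords. *)
Let mean_q k : mean P (q k) <= 10 * s * (k.+1%:R ^+ 2)^-1.
Proof.
have Isum : rintegrable P (fun w => \sum_(M <- index_iota (k.+1 ^ 2) (k.+2 ^ 2))
    S (k.+1 ^ 2) M w ^+ 2).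
  by apply: rintegrable_sum => M; exact: rintegrable_sum_sqr.
rewrite meanZ; last by apply: rintegrableD => //; exact: rintegrable_sum_sqr.
rewrite meanD//; last exact: rintegrable_sum_sqr.
rewrite mean_sum; last by move=> M; exact: rintegrable_sum_sqr.
set x : R := k.+1%:R.
have x1 : 1 <= x by rewrite /x ler1n.
have x0 : 0 < x by lra.
have block M : M \in index_iota (k.+1 ^ 2) (k.+2 ^ 2) ->
    mean P (fun w => S (k.+1 ^ 2) M w ^+ 2) <= (3 * x) * s.
  rewrite mem_index_iota => /andP[kM Mk].
  apply: (le_trans (mean_sum_sqr _ _)); rewrite ler_wpM2r// /x -natrM ler_nat.
  by rewrite leq_subLR; apply: (leq_trans (ltnW Mk)); rewrite !expnS !expn0; lia.
have sumle : \sum_(M <- index_iota (k.+1 ^ 2) (k.+2 ^ 2))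
    mean P (fun w => S (k.+1 ^ 2) M w ^+ 2) <= (3 * x) * ((3 * x) * s).
  apply: (@le_trans _ _ (\sum_(M <- index_iota (k.+1 ^ 2) (k.+2 ^ 2)) (3 * x) * s)).
    by rewrite big_seq [leRHS]big_seq; apply: ler_sum => M Mk; exact: block.
  rewrite big_const_nat iter_addr_0 -(mulr_natl (3 * x * s)) ler_wpM2r//.
    by rewrite mulr_ge0// mulr_ge0// ltW.
  by rewrite /x -natrM ler_nat leq_subLR !expnS !expn0; lia.
have first : mean P (fun w => S 0 (k.+1 ^ 2) w ^+ 2) <= x ^+ 2 * s.
  by apply: (le_trans (mean_sum_sqr _ _)); rewrite subn0 natrX.
apply: (@le_trans _ _ ((x ^+ 4)^-1 * (10 * s * x ^+ 2))).
  rewrite ler_pM2l ?invr_gt0 ?exprn_gt0//; nra.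
by rewrite le_eqVlt; apply/orP; left; apply/eqP; field; exact: lt0r_neq0.
Qed.

Lemma slln_centered : {ae P, forall w,
  (fun M => M%:R^-1 * \sum_(i < M) D i w) @ \oo --> (0 : R)}.
Proof.
have mq k : measurable_fun setT (EFin \o q k).
  by apply/measurable_EFinP; exact: rintegrable_measurable (Iq k).
have q0E k w : (0 <= (q k w)%:E)%E by rewrite lee_fin.
(* The series of the [q k] has mean at most [10 s * 2], so it is finite almost everywhere and its
   terms tend to 0. *)
have Isum : P.-integrable setT (fun w => \sum_(0 <= k <oo) (q k w)%:E)%E.
  apply/integrableP; split.
    by apply: (@ge0_emeasurable_sum _ T R setT (fun k w => (q k w)%:E) xpredT) => // k _;
      exact: mq.
  under eq_integral.
    move=> w _; rewrite gee0_abs; last by apply: nneseries_ge0 => k _ _; exact: q0E.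
    over.
  rewrite integral_nneseries//.
  apply: (@le_lt_trans _ _ (20 * s)%:E); last exact: ltry.
  apply: lime_le.
    by apply: is_cvg_nneseries => k _ _; apply: integral_ge0.
  near=> m; rewrite (eq_bigr (fun k => (mean P (q k))%:E)); last first.
    by move=> k _; rewrite integral_mean.
  rewrite sumEFin lee_fin.
  apply: (@le_trans _ _ (\sum_(0 <= k < m) 10 * s * (k.+1%:R ^+ 2)^-1)).
    by apply: ler_sum => k _; exact: mean_q.
  rewrite -mulr_sumr; have := @sum_inv_sqr_le2 R m.
  set y := \sum_(_ <= _ < _) _ => y2; have := s0; nra.
have := integrable_ae measurableT Isum.
apply: filterS => w /(_ I) fin.
have qw0 : (fun k => q k w) @ \oo --> (0 : R).
  apply: cvg_series_cvg_0; apply: nondecreasing_is_cvgn.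
    apply/nondecreasing_seqP => m; rewrite /series/= big_nat_recr//= lerDl.
    exact: q_ge0.
  exists (fine (\sum_(0 <= k <oo) (q k w)%:E)%E) => _ [m _ <-].
  rewrite -lee_fin fineK// /series/= -sumEFin.
  by apply: nneseries_lim_ge => k _ _; exact: q0E.
apply/cvgr0Pnorm_lt => e e0.
(* The factor 2 pays for [(u + v)^2 <= 2 (u^2 + v^2)], where the sum is split at the last square
   below [M]. *)
have e2 : 0 < e ^+ 2 / 2 by rewrite divr_gt0// exprn_gt0.
have [k0 _ qk0] := (cvgr0Pnorm_lt _).1 qw0 _ e2.
exists (k0.+1 ^ 2)%N => // M /= k0M.
have [k [k0k kM Mk]] := nat_between_squares _ _ k0M.
have := qk0 k k0k; rewrite /= ger0_norm// => qke.
have M0 : 0 < M%:R :> R.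
  by rewrite ltr0n (leq_trans _ kM)// expn_gt0.
rewrite -(@ltr_pXn2r _ 2)// ?nnegrE ?(ltW e0)//.
rewrite -normrX ger0_norm ?sqr_ge0// exprMn.
have -> : \sum_(i < M) D i w = S 0 (k.+1 ^ 2) w + S (k.+1 ^ 2) M w.
  by rewrite /S -big_cat_nat// big_mkord.
set u := S 0 _ w; set v := S _ M w.
have uv : (u + v) ^+ 2 <= 2 * (u ^+ 2 + v ^+ 2).
  have : 0 <= (u - v) ^+ 2 by rewrite sqr_ge0.
  nra.
have vq : u ^+ 2 + v ^+ 2 <= k.+1%:R ^+ 4 * q k w.
  rewrite /q mulrA mulfV ?mul1r ?expf_neq0//.
  rewrite lerD2l (bigD1_seq M) ?iota_uniq ?mem_index_iota ?kM//= lerDl.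
  by apply: sumr_ge0 => j _; exact: sqr_ge0.
have kM2 : k.+1%:R ^+ 4 <= M%:R ^+ 2 :> R.
  by rewrite -!natrX ler_nat -[4%N]/(2 * 2)%N expnM leq_exp2r.
rewrite exprVn mulrC ltr_pdivrMr ?exprn_gt0//.
apply: (le_lt_trans uv); have := q_ge0 k w.
set a := k.+1%:R ^+ 4 in vq kM2 *; set b := M%:R ^+ 2 in kM2 *; set z := q k w in vq qke *.
have b0 : 0 < b by rewrite exprn_gt0.
move=> z0; nra.
Unshelve. all: by end_near. Qed.

End slln.

(** * Weighted averages and templates *)

Section weighted_average.
Context {R : realType}.
Implicit Types (f g : nat -> R) (a b s : R).

Definition wavg M f g : R := (\sum_(i < M) f i)^-1 * \sum_(i < M) f i * g i.

(* From [`|g i| <= s + g i ^+ 4 / s ^+ 3]; with [s] of order sqrt M this gives uniform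
   integrability without any bound on the total weight. *)
Lemma norm_wavg_le M f g s : 0 < s -> (forall i, 0 <= f i) ->
  `|wavg M f g| <= s + (s ^+ 3)^-1 * \sum_(i < M) g i ^+ 4.
Proof.
move=> s0 f0; set G := \sum_(i < M) g i ^+ 4; rewrite /wavg; set B := \sum_(i < M) f i.
have G0 : 0 <= G by apply: sumr_ge0 => i _; rewrite exprn_even_ge0.
have B0 : 0 <= B by apply: sumr_ge0.
have s3 : 0 <= (s ^+ 3)^-1 by rewrite invr_ge0 exprn_ge0// ltW.
have [->|Bn0] := eqVneq B 0.
  by rewrite invr0 mul0r normr0 addr_ge0 ?mulr_ge0// ltW.
have {Bn0}B0' : 0 < B by rewrite lt0r Bn0.
rewrite normrM ger0_norm ?invr_ge0// mulrC ler_pdivrMr//.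
apply: (le_trans (ler_norm_sum _ _ _)).
rewrite mulrC mulrDr mulr_suml mulr_sumr mulr_sumr -big_split/=.
apply: ler_sum => i _; rewrite normrM ger0_norm//.
have fB : f i <= B.
  by rewrite /B (bigD1 i)//= lerDl; apply: sumr_ge0.
have gs : `|g i| <= s + (s ^+ 3)^-1 * g i ^+ 4.
  have g4 : g i ^+ 4 = `|g i| ^+ 4 by rewrite -normrX ger0_norm// exprn_even_ge0.
  rewrite g4; have [gs|sg] := leP `|g i| s.
    by rewrite (le_trans gs)// lerDl mulr_ge0// exprn_ge0.
  rewrite (@le_trans _ _ ((s ^+ 3)^-1 * `|g i| ^+ 4))// ?lerDr ?(ltW s0)//.
  rewrite mulrC ler_pdivlMr ?exprn_gt0// [leRHS]exprS ler_wpM2l//.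
  by rewrite lerXn2r// ?nnegrE// ltW.
have q0 : 0 <= (s ^+ 3)^-1 * g i ^+ 4 by rewrite mulr_ge0// exprn_even_ge0.
apply: (le_trans (ler_wpM2l (f0 i) gs)); rewrite mulrDr lerD2l.
exact: ler_wpM2r.
Qed.

(** The first summand is the Lipschitz constant of the quotient for denominators near [b], the
    second handles denominators far from [b], and the final 1 pays for the fourth-moment term in
    that second case. *)
Definition wavg_cst a b : R :=
  2 * (b + `|a|) / b ^+ 2 + 4 * (`|a| / b + 1) / b ^+ 2 + 1.

(* If [sum f / M] is within [b / 2] of [b], the quotient is Lipschitz in the two
   averages and [2 |z| <= s z^2 + 1 / s] applies; otherwise [1 <= 4 (sum f / M - b)^2 / b^2]
   is combined with [norm_wavg_le]. *)
Lemma dist_wavg_le M f g a b s : 0 < b -> 1 <= s -> (forall i, 0 <= f i) ->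
  `|wavg M f g - a / b| <= wavg_cst a b *
    (s * (M%:R^-1 * (\sum_(i < M) f i * g i) - a) ^+ 2 +
     s * (M%:R^-1 * (\sum_(i < M) f i) - b) ^+ 2 +
     s^-1 + (s ^+ 3)^-1 * \sum_(i < M) g i ^+ 4).
Proof.
move=> b0 s1 f0; have s0 : 0 < s by lra.
set G := \sum_(i < M) g i ^+ 4.
set dA := _ * _ - a; set dB := _ * _ - b.
have G0 : 0 <= (s ^+ 3)^-1 * G.
  apply: mulr_ge0; first by rewrite invr_ge0 exprn_ge0// ltW.
  by apply: sumr_ge0 => i _; rewrite exprn_even_ge0.
set c1 := 2 * (b + `|a|) / b ^+ 2; set c2 := 4 * (`|a| / b + 1) / b ^+ 2.
have c10 : 0 <= c1 by rewrite divr_ge0 ?mulr_ge0 ?addr_ge0 ?sqr_ge0// ltW.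
have ab0 : 0 <= `|a| / b by rewrite divr_ge0// ltW.
have c20 : 0 <= c2 by rewrite divr_ge0 ?mulr_ge0 ?addr_ge0 ?sqr_ge0// ltW.
have sA : 0 <= s * dA ^+ 2 by rewrite mulr_ge0 ?sqr_ge0// ltW.
have sB : 0 <= s * dB ^+ 2 by rewrite mulr_ge0 ?sqr_ge0// ltW.
have si : 0 <= s^-1 by rewrite invr_ge0 ltW.
rewrite /wavg_cst -/c1 -/c2.
have [dBle|dBgt] := leP `|dB| (b / 2).
  have bdB : b / 2 <= b + dB by move: dBle; rewrite ler_norml => /andP[]; lra.
  have bdB0 : 0 < b + dB by lra.
  have -> : wavg M f g = (a + dA) / (b + dB).
    rewrite /dA /dB [a + _]addrC [b + _]addrC !subrK /wavg.
    have M0 : M%:R != 0 :> R.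
      apply/eqP => M0; move: bdB0; rewrite /dB M0 invr0 mul0r; lra.
    by rewrite invfM invrK mulrACA mulVf// mul1r mulrC.
  have young (z : R) : 2 * `|z| <= s * z ^+ 2 + s^-1.
    rewrite -(real_normK (num_real z)); set t := `|z|.
    have -> : s * t ^+ 2 + s^-1 = 2 * t + s^-1 * (s * t - 1) ^+ 2.
      by field; exact: lt0r_neq0.
    by rewrite lerDl mulr_ge0// sqr_ge0.
  have -> : (a + dA) / (b + dB) - a / b = (dA * b - a * dB) / (b * (b + dB)).
    by field; rewrite !lt0r_neq0.
  rewrite normrM [`|(b * _)^-1|]ger0_norm ?invr_ge0 ?mulr_ge0 ?(ltW b0) ?(ltW bdB0)//.
  have num : `|dA * b - a * dB| <= (b + `|a|) * (`|dA| + `|dB|).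
    rewrite (le_trans (ler_normB _ _))// !normrM (ger0_norm (ltW b0)).
    have := normr_ge0 a; have := normr_ge0 dA; have := normr_ge0 dB; nra.
  have den : (b * (b + dB))^-1 <= 2 / b ^+ 2.
    rewrite -[2 / _]invrK invf_div lef_pV2 ?posrE ?mulr_gt0 ?divr_gt0 ?exprn_gt0//.
    by rewrite expr2 -mulrA ler_pM2l.
  have : `|dA * b - a * dB| * (b * (b + dB))^-1 <=
      (b + `|a|) * (`|dA| + `|dB|) * (2 / b ^+ 2).
    by apply: ler_pM => //; rewrite invr_ge0 mulr_ge0 ?(ltW b0) ?(ltW bdB0).
  move=> /le_trans; apply.
  have -> : (b + `|a|) * (`|dA| + `|dB|) * (2 / b ^+ 2) = c1 * (`|dA| + `|dB|).
    by rewrite /c1; field; exact: lt0r_neq0.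
  have := young dA; have := young dB.
  set u := `|dA|; set v := `|dB|; set p := s * dA ^+ 2 in sA *; set q := s * dB ^+ 2 in sB *.
  move=> vq up; set g' := (s ^+ 3)^-1 * G in G0 *.
  set X := p + q + s^-1 + g'; have X0 : 0 <= X by rewrite /X; lra.
  have uvX : u + v <= X by rewrite /X; lra.
  by have := ler_wpM2l c10 uvX; have := mulr_ge0 c20 X0; lra.
have dB2 : 1 <= 4 * dB ^+ 2 / b ^+ 2.
  rewrite ler_pdivlMr ?exprn_gt0// mul1r -(real_normK (num_real dB)); nra.
have : `|wavg M f g - a / b| <= (`|a| / b + 1) * s + (s ^+ 3)^-1 * G.
  apply: (le_trans (ler_normB _ _)); rewrite [`|a / b|]normrM normfV (ger0_norm (ltW b0)).
  have := norm_wavg_le M f g s s0 f0; rewrite -/G; nra.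
move=> /le_trans; apply.
have : (`|a| / b + 1) * s <= c2 * (s * dB ^+ 2).
  have -> : c2 * (s * dB ^+ 2) = (`|a| / b + 1) * s * (4 * dB ^+ 2 / b ^+ 2).
    by rewrite /c2; field; exact: lt0r_neq0.
  by rewrite ler_peMr// mulr_ge0 ?addr_ge0// ltW.
set p := s * dA ^+ 2 in sA *; set q := s * dB ^+ 2 in sB *.
set g' := (s ^+ 3)^-1 * G in G0 *; set t := _ * s => tq.
set X := p + q + s^-1 + g'; have X0 : 0 <= X by rewrite /X; lra.
have qX : q <= X by rewrite /X; lra.
have gX : g' <= X by rewrite /X; lra.
by have := ler_wpM2l c20 qX; have := mulr_ge0 c10 X0; lra.
Qed.

End weighted_average.

Definition westimator {R : realType} {d : nat} (f : 'rV[R]_d -> R) (M : nat)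
    (nn : nat -> 'rV[R]_d) : 'rV[R]_d :=
  (\sum_(i < M) f (nn i))^-1 *: \sum_(i < M) f (nn i) *: nn i.

Lemma dotv_westimator {R : realType} {d : nat} (f : 'rV[R]_d -> R) M nn (y : 'rV[R]_d) :
  dotv (westimator f M nn) y = wavg M (f \o nn) (fun i => dotv (nn i) y).
Proof.
rewrite /westimator dotvZl dotv_suml /wavg; congr (_ * _).
by apply: eq_bigr => i _; rewrite dotvZl.
Qed.

Lemma exists_ord_neq (L : nat) (l : 'I_L) : (2 <= L)%N -> exists k : 'I_L, k != l.
Proof.
move=> L2; apply/existsP; rewrite -negb_forall; apply/negP => /forallP all.
have : (#|'I_L| <= 1)%N.
  by apply/fintype_le1P => i j; rewrite (eqP (all i)) (eqP (all j)).
by rewrite card_ord leqNgt L2.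
Qed.

(** * Geometry of the templates and the two weights *)

Section templates.
Context {R : realType} {L d : nat} (x : 'I_L -> 'rV[R]_d).
Hypothesis xinj : injective x.
Hypothesis xnorm : forall l k : 'I_L, enorm (x l) = enorm (x k).
Implicit Types (v : 'rV[R]_d) (l k r : 'I_L).

(** Strict Cauchy-Schwarz: by equality of norms [|x_l - x_r|^2 = 2 (|x_l|^2 - <x_l, x_r>)], and the
    left side is positive by injectivity. *)
Lemma dotv_template_lt l r : r != l -> dotv (x l) (x r) < dotv (x l) (x l).
Proof.
move=> rl.
have nE : dotv (x r) (x r) = dotv (x l) (x l).
  have := congr1 (fun z => z ^+ 2) (xnorm r l).
  by rewrite /enorm !sqr_sqrtr ?dotv_ge0.
have : 0 < dotv (x l - x r) (x l - x r).
  rewrite lt0r dotv_ge0 dotv_eq0 subr_eq0 andbT.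
  by apply: contra rl => /eqP/xinj ->.
by rewrite dotvBl !dotvBr nE (dotvC (x r)); lra.
Qed.

(** Along [x_l] the score of [l] grows strictly faster than every other one. The shift is an integer
    multiple so that only countably many null sets arise when it is applied to a random point. *)
Lemma template_shift_lt l v : exists k : nat, forall r, r != l ->
  dotv (v + k%:R *: x l) (x r) < dotv (v + k%:R *: x l) (x l).
Proof.
pose D r := dotv (x l) (x l) - dotv (x l) (x r).
pose N r := `|dotv v (x r) - dotv v (x l)|.
(* The sum dominates every ratio [N r / D r], so one integer above it overtakes all competitors at
   once. *)
pose B := \sum_(r | r != l) N r / D r.
have D0 r : r != l -> 0 < D r by move=> rl; rewrite subr_gt0 dotv_template_lt.
have t0 r : r != l -> 0 <= N r / D r.
  by move=> rl; apply: divr_ge0; [exact: normr_ge0|exact: ltW (D0 r rl)].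
have B0 : 0 <= B by apply: sumr_ge0.
exists (Num.bound B) => r rl.
have : N r / D r < (Num.bound B)%:R.
  apply: le_lt_trans (archi_boundP B0).
  rewrite /B (bigD1 r)//= lerDl; apply: sumr_ge0 => k /andP[kl _]; exact: t0.
rewrite ltr_pdivrMr ?D0// => lt.
have := ler_norm (dotv v (x r) - dotv v (x l)); rewrite -/(N r) => le.
by rewrite !dotvDl !dotvZl; move: lt; rewrite /D mulrBr; lra.
Qed.

Lemma template_gap l : exists2 delta : R, 0 < delta &
  forall r, r != l -> delta <= dotv (x l) (x l) - dotv (x l) (x r).
Proof.
pose D r := dotv (x l) (x l) - dotv (x l) (x r).
have D0 r : r != l -> 0 < D r by move=> rl; rewrite subr_gt0 dotv_template_lt.
have S0 : 0 <= \sum_(r | r != l) (D r)^-1.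
  by apply: sumr_ge0 => r rl; rewrite invr_ge0 ltW// D0.
(* An explicit positive lower bound replacing the minimum of the [D r]; the added 1 keeps it well
   defined even for an empty sum. *)
exists (1 + \sum_(r | r != l) (D r)^-1)^-1; first by rewrite invr_gt0; lra.
move=> r rl; rewrite -/(D r) -[leRHS]invrK lef_pV2 ?posrE ?invr_gt0 ?D0//; last by lra.
rewrite (bigD1 r)//=.
have : 0 <= \sum_(k | (k != l) && (k != r)) (D k)^-1.
  by apply: sumr_ge0 => k /andP[kl _]; rewrite invr_ge0 ltW// D0.
by set y := \sum_(_ | _) _; set z := (D r)^-1; lra.
Qed.

Definition hard_weight (l : 'I_L) (v : 'rV[R]_d) : R :=
  [forall r : 'I_L, dotv v (x r) <= dotv v (x l)]%:R.

Lemma hard_estE l M nn : hard_est x M nn l = westimator (hard_weight l) M nn.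
Proof.
rewrite /hard_est /westimator; congr (_^-1 *: _).
  rewrite -sum1_size natr_sum big_filter big_mkcond.
  rewrite -[X in iota 0 X]subn0 -/(index_iota 0 M) big_mkord.
  by apply: eq_bigr => i _; rewrite /hard_weight; case: [forall _, _].
rewrite big_filter big_mkcond -[X in iota 0 X]subn0 -/(index_iota 0 M) big_mkord.
apply: eq_bigr => i _; rewrite /hard_weight.
by case: [forall _, _]; rewrite ?scale1r ?scale0r.
Qed.

Lemma measurable_hard_weight l : measurable_fun setT (hard_weight l).
Proof.
pose C r := [set v : 'rV[R]_d | dotv v (x r) <= dotv v (x l)].
have mC r : measurable (C r).
  rewrite -[C r]setTI; apply: measurable_fun_le => //.
    exact: measurable_dotv.
  exact: measurable_dotv.
have -> : hard_weight l = \1_(\big[setI/setT]_(r < L) C r).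
  apply/funext => v; rewrite indicE /hard_weight; congr (_%:R); congr (nat_of_bool _).
  apply/forallP/idP => [Cv|/set_mem].
    by rewrite inE -bigcap_seq => r _; exact: Cv.
  by rewrite -bigcap_seq => Cv r; apply: Cv; rewrite /= mem_index_enum.
by apply: measurable_indic; apply: bigsetI_measurable => r _; exact: mC.
Qed.

Lemma hard_weight_ge0 l v : 0 <= hard_weight l v.
Proof. exact: ler0n. Qed.

Lemma hard_weight_le1 l v : hard_weight l v <= 1.
Proof. by rewrite /hard_weight; case: [forall _, _]. Qed.

Lemma hard_weight_gt0 l v :
  (forall r, r != l -> dotv v (x r) < dotv v (x l)) -> 0 < hard_weight l v.
Proof.
move=> lt; rewrite /hard_weight; have -> // : [forall r, dotv v (x r) <= dotv v (x l)].
by apply/forallP => r; have [->//|/lt/ltW] := eqVneq r l.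
Qed.

Let S0 l v : 0 < \sum_(r < L) expR (dotv v (x r)).
Proof.
rewrite (bigD1 l)//= ltr_pwDl ?expR_gt0//.
by apply: sumr_ge0 => r _; exact: expR_ge0.
Qed.

Lemma measurable_soft_weight l : measurable_fun setT ((soft_weight x)^~ l).
Proof.
have me r : measurable_fun setT (fun v : 'rV[R]_d => expR (dotv v (x r))).
  by apply: measurableT_comp => //; exact: measurable_dotv.
apply: measurable_funM => //; apply: measurable_inv_ge0.
  by move=> v; rewrite ltW// (S0 l).
by apply: measurable_sum => r.
Qed.

Lemma soft_weight_gt0 l v : 0 < soft_weight x v l.
Proof. by rewrite divr_gt0 ?expR_gt0 ?(S0 l). Qed.

Lemma soft_weight_le1 l v : soft_weight x v l <= 1.
Proof.
rewrite /soft_weight ler_pdivrMr ?(S0 l)// mul1r (bigD1 l)//= lerDl.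
by apply: sumr_ge0 => r _; exact: expR_ge0.
Qed.

Lemma soft_weight_lt1 l v : (2 <= L)%N -> soft_weight x v l < 1.
Proof.
move=> L2; rewrite /soft_weight ltr_pdivrMr ?(S0 l)// mul1r (bigD1 l)//= ltrDl.
have [k kl] := exists_ord_neq _ l L2.
rewrite (bigD1 k)//= ltr_pwDl ?expR_gt0//.
by apply: sumr_ge0 => r _; exact: expR_ge0.
Qed.

(** Shifting by [- t x_l] multiplies the exponential of [l] by [q] and every other one by at least
    [q (1 + t delta)]. The common [q] cancels in the quotient, leaving at most
    [E / (E + (1 + t delta) O)]; with [p = E / (E + O)], the product [p (1 - p)] is
    [E O / (E + O)^2]. *)
Lemma soft_weight_shift l v (delta t : R) : 0 < delta ->
  (forall r, r != l -> delta <= dotv (x l) (x l) - dotv (x l) (x r)) ->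
  0 < t <= 1 ->
  soft_weight x (v - t *: x l) l <= soft_weight x v l -
    delta / (1 + delta) * t * (soft_weight x v l * (1 - soft_weight x v l)).
Proof.
move=> d0 gap /andP[t0 t1]; rewrite /soft_weight.
rewrite (bigD1 l)//= [in leRHS](bigD1 l)//=.
set E := expR (dotv v (x l)); set O := \sum_(r < L | r != l) expR (dotv v (x r)).
set E' := expR (dotv (v - _) (x l)); set O' := \sum_(r < L | r != l) _.
have E0 : 0 < E by exact: expR_gt0.
have O0 : 0 <= O by apply: sumr_ge0 => r _; exact: expR_ge0.
pose q := expR (- (t * dotv (x l) (x l))).
have q0 : 0 < q by exact: expR_gt0.
have E'E : E' = E * q by rewrite /E' dotvBl dotvZl expRD.
have O'O : (1 + t * delta) * O * q <= O'.
  rewrite mulr_sumr mulr_suml; apply: ler_sum => r rl.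
  rewrite dotvBl dotvZl expRD (mulrC (1 + _)) -mulrA ler_wpM2l ?expR_ge0//.
  have -> : - (t * dotv (x l) (x r)) =
      t * (dotv (x l) (x l) - dotv (x l) (x r)) + - (t * dotv (x l) (x l)).
    by ring.
  rewrite expRD ler_wpM2r ?expR_ge0//; apply: le_trans (expR_ge1Dx _).
  by rewrite lerD2l ler_wpM2l ?(ltW t0)// gap.
have td : 0 < t * delta by rewrite mulr_gt0.
have EO0 : 0 < E + O by lra.
have O1 : 0 <= (1 + t * delta) * O by apply: mulr_ge0 => //; lra.
have EO1 : 0 < E + (1 + t * delta) * O by lra.
apply: (@le_trans _ _ (E / (E + (1 + t * delta) * O))).
  have -> : E / (E + (1 + t * delta) * O) = E' / (E' + (1 + t * delta) * O * q).
    by rewrite E'E -mulrDl; field; rewrite !lt0r_neq0.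
  have E'0 : 0 < E' by exact: expR_gt0.
  rewrite ler_pM2l// lef_pV2 ?posrE ?lerD2l//.
    by apply: (@lt_le_trans _ _ E') => //; rewrite lerDl (le_trans _ O'O)// mulr_ge0// ltW.
  by rewrite (@lt_le_trans _ _ E')// lerDl mulr_ge0// ltW.
have -> : E / (E + O) * (1 - E / (E + O)) = E * O / (E + O) ^+ 2.
  by field; exact: lt0r_neq0.
rewrite lerBrDr -lerBrDl.
have -> : E / (E + O) - E / (E + (1 + t * delta) * O) =
    t * delta * (E * O) / (E + O) * (E + (1 + t * delta) * O)^-1.
  by field; rewrite !lt0r_neq0.
have -> : delta / (1 + delta) * t * (E * O / (E + O) ^+ 2) =
    t * delta * (E * O) / (E + O) * ((1 + delta) * (E + O))^-1.
  by field; rewrite !lt0r_neq0//; lra.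
rewrite ler_wpM2l//.
  by rewrite divr_ge0 ?(ltW EO0)// mulr_ge0 ?(ltW td)// mulr_ge0// ltW.
(* Here [t <= 1] bounds [E + (1 + t delta) O] by [(1 + delta) (E + O)], the origin of the factor
   [delta / (1 + delta)]. *)
rewrite lef_pV2 ?posrE ?mulr_gt0//; last by lra.
have : t * delta * O <= delta * O by rewrite ler_wpM2r// ler_piMl// ltW.
have : 0 <= delta * E by rewrite mulr_ge0// ltW.
lra.
Qed.

End templates.

(** * Standard Gaussian vectors *)

Section gaussian_vectors.
Context {R : realType} {dT : measure_display} {T : measurableType dT}.
Variables (P : probability T R) (d : nat) (n : nat -> 'I_d -> T -> R).
Hypothesis mn : forall i j, measurable_fun setT (n i j).
Hypothesis n01 : forall i j (B : set R), measurable B ->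
  P (n i j @^-1` B) = normal_prob 0 1 B.
Hypothesis n_indep : mutually_independent P (fun ij : nat * 'I_d => n ij.1 ij.2).
Local Notation V := 'rV[R]_d.
Local Notation N01 := (@normal_prob R 0 1).

Implicit Types (f h : V -> R) (y : V).

Definition rvec (i : nat) (w : T) : V := \row_(j < d) n i j w.

Lemma measurable_rvec i : measurable_fun setT (rvec i).
Proof.
by apply: measurable_row_fun => j; under eq_fun do rewrite mxE; exact: mn.
Qed.

Lemma rvec_boxE i (B : 'I_d -> set R) : (forall j, measurable (B j)) ->
  P (rvec i @^-1` box B) = (\prod_(j < d) normal_prob 0 1 (B j))%E.
Proof.
move=> mB; have /= := n_indep [seq (i, j) | j <- index_enum 'I_d] (fun ij => B ij.2).
rewrite !big_map/= => inE.
have -> : rvec i @^-1` box B = \big[setI/setT]_(j < d) (n i j @^-1` B j).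
  rewrite -bigcap_seq; apply/seteqP; split => w Bw j.
    by move=> _; have /= := Bw j; rewrite mxE.
  by rewrite /= mxE; apply: Bw; rewrite /= mem_index_enum.
rewrite inE//; first by apply: eq_bigr => j _; exact: n01.
by rewrite map_inj_uniq ?index_enum_uniq// => j k [].
Qed.

Lemma rvec_box2E i k (B C : 'I_d -> set R) : i != k ->
  (forall j, measurable (B j)) -> (forall j, measurable (C j)) ->
  P (rvec i @^-1` box B `&` rvec k @^-1` box C) =
  (P (rvec i @^-1` box B) * P (rvec k @^-1` box C))%E.
Proof.
move=> ik mB mC; rewrite !rvec_boxE//.
(* Joint independence is used on the indices of both vectors at once: the list is duplicate-free
   because [i != k], and the first component of an index selects [B] or [C]. *)
have /= := n_indep ([seq (i, j) | j <- index_enum 'I_d] ++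
  [seq (k, j) | j <- index_enum 'I_d])
  (fun ij => if ij.1 == i then B ij.2 else C ij.2).
rewrite !big_cat !big_map/= => inE.
have boxcap l (D : 'I_d -> set R) :
    rvec l @^-1` box D = \big[setI/setT]_(j < d) (n l j @^-1` D j).
  rewrite -bigcap_seq; apply/seteqP; split => w Bw j.
    by move=> _; have /= := Bw j; rewrite mxE.
  by rewrite /= mxE; apply: Bw; rewrite /= mem_index_enum.
rewrite !boxcap.
under eq_bigr do rewrite -[B _](if_same (i == i)).
have ki : (k == i) = false by rewrite eq_sym; exact/negbTE.
move: inE; rewrite eqxx ki => ->.
- by congr (_ * _)%E; apply: eq_bigr => j _; exact: n01.
- rewrite cat_uniq !map_inj_uniq ?index_enum_uniq ?andbT/=; last 2 first.
  - by move=> a b [].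
  - by move=> a b [].
  by apply/hasPn => _ /mapP[a _ ->]; apply/mapP => -[b _ [/eqP]]; rewrite ki.
- by move=> ij _; case: ifP.
Qed.

Lemma rvec_law i k A : measurable A -> P (rvec i @^-1` A) = P (rvec k @^-1` A).
Proof.
move=> mA.
unshelve refine (row_measure_unique (pushforward P (rvec i))
  (pushforward P (rvec k)) _ _ A mA).
- exact: measurable_rvec.
- exact: measurable_rvec.
- by rewrite /= /pushforward preimage_setT probability_setT ltry.
- by move=> B mB; rewrite /= /pushforward !rvec_boxE.
Qed.

Let rep (j : 'I_d) (v : 'rV[R]_d) (x : R) : 'rV[R]_d :=
  \row_k (if k == j then x else v 0 k).

Let measurable_rep i j :
  measurable_fun setT (fun z : T * R => rep j (rvec i z.1) z.2).
Proof.
apply: measurable_row_fun => k; under eq_fun do rewrite mxE.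
case: (k == j); first exact: measurable_snd.
under eq_fun do rewrite mxE.
exact: (measurableT_comp (mn i k)).
Qed.

(** Both laws give a box the product of the Gaussian masses of its sides. The old coordinate [j] is
    discarded, so its side becomes the full line in [B'], while the fresh coordinate contributes
    [B j]. *)
Let rep_law i j (A : set 'rV[R]_d) : measurable A ->
  P (rvec i @^-1` A) = (P \x N01)%E ((fun z : T * R => rep j (rvec i z.1) z.2) @^-1` A).
Proof.
move=> mA.
unshelve refine (row_measure_unique (pushforward P (rvec i))
  (pushforward (P \x N01)%E (fun z : T * R => rep j (rvec i z.1) z.2)) _ _ A mA).
- exact: measurable_rvec.
- exact: measurable_rep.
- by rewrite /= /pushforward preimage_setT probability_setT ltry.
move=> B mB; rewrite /= /pushforward.
pose B' k := if k == j then setT else B k.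
have mB' k : measurable (B' k) by rewrite /B'; case: ifP.
have -> : (fun z : T * R => rep j (rvec i z.1) z.2) @^-1` box B =
    (rvec i @^-1` box B') `*` B j.
  apply/seteqP; split => [[w x] Bwx|[w x] /= [B'w Bx] k].
    split=> [k|]; last by have /= := Bwx j; rewrite mxE eqxx.
    by rewrite /B'; case: eqP => // kj; have /= := Bwx k; rewrite mxE; case: eqP.
  by have := B'w k; rewrite !mxE /B'; case: eqP => [->|].
have mrB' : measurable (rvec i @^-1` box B').
  have := measurable_rvec i measurableT _ (measurable_box _ mB').
  by rewrite setTI.
rewrite product_measure1E//; last exact: mB.
transitivity (P (rvec i @^-1` box B') * N01 (B j))%E; last by [].
rewrite (rvec_boxE i B mB) (rvec_boxE i B' mB').
rewrite [LHS](bigD1 j)//= [in RHS](bigD1 j)//= {1}/B' eqxx probability_setT mul1e muleC.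
by congr (_ * _)%E; apply: eq_bigr => k /negbTE kj; rewrite /B' kj.
Qed.

(* The coordinate [j] may be resampled independently of the others. *)
Let ge0_integral_rep i j (f : 'rV[R]_d -> \bar R) :
  measurable_fun setT f -> (forall v, 0 <= f v)%E ->
  (\int[P]_w f (rvec i w) = \int[P]_w \int[N01]_x f (rep j (rvec i w) x))%E.
Proof.
move=> mf f0.
rewrite (eq_law_integral _ _ _ _ _ _ P (P \x N01)%E _ _ f _
  (measurable_rep i j) (rep_law i j))//.
  by rewrite fubini_tonelli1//; exact: (measurableT_comp mf (measurable_rep i j)).
exact: measurable_rvec.
Qed.

(** With coordinate [j] resampled and the others frozen, the inner integral is a one-dimensional
    Gaussian shift. *)
Let ge0_cameron_martin_coord i j (c : R) (f : 'rV[R]_d -> \bar R) :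
  measurable_fun setT f -> (forall v, 0 <= f v)%E ->
  (\int[P]_w (f (rvec i w + c *: delta_mx 0 j)%R * (expR (c ^+ 2 / 2))%:E) =
   \int[P]_w (f (rvec i w) * (expR (c * rvec i w 0 j))%:E))%E.
Proof.
move=> mf f0.
have mfc : measurable_fun setT
    (fun v : 'rV[R]_d => f (v + c *: delta_mx 0 j)%R * (expR (c ^+ 2 / 2))%:E)%E.
  by apply: emeasurable_funM => //; apply: measurableT_comp => //; exact: measurable_shift.
have mfe : measurable_fun setT
    (fun v : 'rV[R]_d => f v * (expR (c * v 0 j))%:E)%E.
  apply: emeasurable_funM => //; apply/measurable_EFinP.
  apply: measurableT_comp => //; apply: measurable_funM => //.
  exact: measurable_coord.
have fc0 v : (0 <= f (v + c *: delta_mx 0 j)%R * (expR (c ^+ 2 / 2))%:E)%E.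
  by rewrite mule_ge0// lee_fin expR_ge0.
have fe0 v : (0 <= f v * (expR (c * v 0 j))%:E)%E.
  by rewrite mule_ge0// lee_fin expR_ge0.
rewrite (ge0_integral_rep i j _ mfc fc0) (ge0_integral_rep i j _ mfe fe0).
apply: eq_integral => w _.
pose g x := f (rep j (rvec i w) x).
have mg : measurable_fun setT g.
  apply: measurableT_comp => //; apply: measurable_row_fun => k.
  under eq_fun do rewrite mxE.
  case: (k == j); [exact: measurable_id | exact: measurable_cst].
have := ge0_integral_normal_shift g c mg (fun x => f0 _).
under eq_integral.
  move=> x _.
  have -> : g (x + c)%R = f (rep j (rvec i w) x + c *: delta_mx 0 j)%R.
    congr f; apply/rowP => k; rewrite !mxE eqxx/=.
    by case: eqP => _; rewrite ?mulr1 ?mulr0 ?addr0.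
  over.
move=> ->; apply: eq_integral => x _.
by congr (_ * (expR (_ * _))%:E)%E; rewrite mxE eqxx.
Qed.

(** One coordinate is shifted at a time; the induction is over all [f] because the exponential of
    the remaining shift gets absorbed into the integrand. *)
Lemma ge0_cameron_martin i (y : 'rV[R]_d) (f : 'rV[R]_d -> \bar R) :
  measurable_fun setT f -> (forall v, 0 <= f v)%E ->
  (\int[P]_w (f (rvec i w + y)%R * (expR (dotv y y / 2))%:E) =
   \int[P]_w (f (rvec i w) * (expR (dotv (rvec i w) y))%:E))%E.
Proof.
have -> : y = \sum_(j <- index_enum 'I_d) y 0 j *: delta_mx 0 j.
  exact: row_sum_delta.
elim: (index_enum 'I_d) f => [f _ _|j s IH f mf f0].
  rewrite big_nil; apply: eq_integral => w _.
  by rewrite addr0 dotv0l dotvC dotv0l mul0r.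
rewrite big_cons; set u := \sum_(k <- s) _; set c := y 0 j; set e := c *: _.
have mfe : measurable_fun setT (fun v : 'rV[R]_d => f (v + e)%R).
  by apply: measurableT_comp => //; exact: measurable_shift.
(* The cross term [c * u 0 j] is kept because the induction does not record that [j] is absent from
   [s]. It reappears below when [e] shifts the factor [expR (dotv v u)]. *)
transitivity (\int[P]_w (f (rvec i w + u + e)%R * (expR (dotv u u / 2))%:E *
    (expR (c * u 0 j + c ^+ 2 / 2))%:E))%E.
  apply: eq_integral => w _; rewrite -muleA -EFinM -expRD -addrA (addrC u).
  congr (_ * (expR _)%:E)%E.
  rewrite !(dotvDl, dotvDr) (dotvC e u) /e !(dotvZl, dotvZr) !dotv_delta.
  by rewrite mxE !eqxx mulr1; field.
rewrite ge0_integralZr//; last 2 first.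
- apply: emeasurable_funM => //; apply: (measurableT_comp mfe).
  by apply: (measurableT_comp (measurable_shift u)); exact: measurable_rvec.
- by move=> w _; rewrite mule_ge0 ?lee_fin ?expR_ge0.
rewrite (IH (fun v => f (v + e)%R))// -ge0_integralZr//; last 2 first.
- apply: emeasurable_funM; first by apply: (measurableT_comp mfe); exact: measurable_rvec.
  apply/measurable_EFinP; apply: measurableT_comp => //.
  by apply: measurable_dotv; exact: measurable_rvec.
- by move=> w _; rewrite mule_ge0 ?lee_fin ?expR_ge0.
have := ge0_cameron_martin_coord i j c (fun v => f v * (expR (dotv v u))%:E)%E.
rewrite -/e => CM; transitivity (\int[P]_w (f (rvec i w + e)%R *
    (expR (dotv (rvec i w + e) u))%:E * (expR (c ^+ 2 / 2))%:E))%E.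
  apply: eq_integral => w _; rewrite -!muleA -!EFinM -!expRD.
  congr (_ * (expR _)%:E)%E; rewrite dotvDl -addrA; congr (_ + (_ + _)).
  by rewrite /e dotvZl dotvC dotv_delta.
rewrite CM//.
- apply: eq_integral => w _; rewrite -!muleA -!EFinM -!expRD.
  congr (_ * (expR _)%:E)%E; rewrite dotvDr addrC; congr (_ + _).
  by rewrite /e dotvZr dotv_delta.
- apply: emeasurable_funM => //; apply/measurable_EFinP.
  by apply: measurableT_comp => //; exact: measurable_dotv.
- by move=> v; rewrite mule_ge0 ?lee_fin ?expR_ge0.
Qed.

Lemma mean_rvec i k h : measurable_fun setT h ->
  mean P (h \o rvec i) = mean P (h \o rvec k).
Proof.
move=> mh; rewrite /mean /Rintegral; congr fine.
apply: (eq_law_integral_signed _ _ _ _ _ _ P P (rvec i) (rvec k) (EFin \o h)).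
- exact: measurable_rvec.
- exact: measurable_rvec.
- by move=> A mA; exact: (rvec_law).
- exact/measurable_EFinP.
Qed.

Lemma rintegrable_rvec i k h : measurable_fun setT h ->
  rintegrable P (h \o rvec i) -> rintegrable P (h \o rvec k).
Proof.
move=> mh; apply: (eq_law_integrable _ _ _ _ _ _ P P (rvec i) (rvec k) (EFin \o h)).
- exact: measurable_rvec.
- exact: measurable_rvec.
- by move=> A mA; exact: (rvec_law).
- exact/measurable_EFinP.
Qed.

(** For fixed [E], both sides are finite measures in [A] that agree on boxes. Applying this to one
    vector and then to the other passes from pairs of boxes to pairs of arbitrary measurable
    sets. *)
Let rvec_indep_event i (E : set T) : measurable E ->
  (forall B, (forall j, measurable (B j)) ->
    P (rvec i @^-1` box B `&` E) = (P (rvec i @^-1` box B) * P E)%E) ->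
  forall A, measurable A ->
    P (rvec i @^-1` A `&` E) = (P (rvec i @^-1` A) * P E)%E.
Proof.
move=> mE PE A mA.
have PE0 : 0 <= fine (P E) by rewrite fine_ge0.
have PEfin : P E \is a fin_num by exact: fin_num_measure.
pose Ni : {mfun T >-> V} := mfun_Sub (mem_set (measurable_rvec i)).
transitivity (mscale (NngNum PE0) (distribution P Ni) A); last first.
  by rewrite /mscale/= fineK// muleC.
unshelve refine (row_measure_unique (pushforward (mrestr P mE) (rvec i))
  (mscale (NngNum PE0) (distribution P Ni)) _ _ A mA).
- exact: measurable_rvec.
- rewrite /pushforward /= /mrestr -ge0_fin_numE//; apply: fin_num_measure.
  apply: measurableI => //.
  by have := measurable_rvec i measurableT _ measurableT; rewrite setTI.
- move=> B mB; transitivity (P (rvec i @^-1` box B) * P E)%E; first exact: PE.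
  transitivity ((fine (P E))%:E * P (rvec i @^-1` box B))%E; last by [].
  by rewrite fineK// muleC.
Qed.

Lemma rvec_indep i k (A B : set V) : i != k -> measurable A -> measurable B ->
  P (rvec i @^-1` A `&` rvec k @^-1` B) =
  (P (rvec i @^-1` A) * P (rvec k @^-1` B))%E.
Proof.
move=> ik mA mB.
have mrv l (C : set V) : measurable C -> measurable (rvec l @^-1` C).
  by move=> mC; have := measurable_rvec l measurableT _ mC; rewrite setTI.
apply: rvec_indep_event => //; first exact: mrv.
move=> C mC; rewrite setIC muleC; apply: rvec_indep_event => //.
  by apply: mrv; exact: measurable_box.
move=> D mD; rewrite setIC muleC.
exact: (rvec_box2E).
Qed.

(** The joint law is the product of the marginals; Tonelli applied to [|h| |h'|] gives
    integrability, then Fubini factors the mean. *)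
Lemma mean_indep i k h h' : i != k ->
  measurable_fun setT h -> measurable_fun setT h' ->
  rintegrable P (h \o rvec i) -> rintegrable P (h' \o rvec k) ->
  rintegrable P (fun w => h (rvec i w) * h' (rvec k w)) /\
  mean P (fun w => h (rvec i w) * h' (rvec k w)) =
  mean P (h \o rvec i) * mean P (h' \o rvec k).
Proof.
move=> ik mh mh' Ih Ih'.
pose Ni : {mfun T >-> V} := mfun_Sub (mem_set (measurable_rvec i)).
pose Nk : {mfun T >-> V} := mfun_Sub (mem_set (measurable_rvec k)).
pose X w := (rvec i w, rvec k w).
have mX : measurable_fun setT X.
  by apply: measurable_fun_pair; exact: measurable_rvec.
have XQ := indep_law_prod _ _ _ _ _ _ P (distribution P Ni) (distribution P Nk) X mX.
have {}XQ A : measurable A ->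
    P (X @^-1` A) = (distribution P Ni \x distribution P Nk)%E (idfun @^-1` A).
  by apply: XQ => B C mB mC; exact: rvec_indep.
pose F (z : V * V) : \bar R := (h z.1 * h' z.2)%:E.
have mF : measurable_fun setT F.
  apply/measurable_EFinP; apply: measurable_funM.
    exact: (measurableT_comp mh measurable_fst).
  exact: (measurableT_comp mh' measurable_snd).
have mEh : measurable_fun setT (EFin \o h) by exact/measurable_EFinP.
have mEh' : measurable_fun setT (EFin \o h') by exact/measurable_EFinP.
have Qh : (distribution P Ni).-integrable setT (EFin \o h).
  exact: (eq_law_integrable _ _ _ _ _ _ P (distribution P Ni) (rvec i) idfun
    (EFin \o h) (measurable_rvec i) (@measurable_id _ _ _) (fun _ _ => erefl)
    mEh Ih).
have Qh' : (distribution P Nk).-integrable setT (EFin \o h').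
  exact: (eq_law_integrable _ _ _ _ _ _ P (distribution P Nk) (rvec k) idfun
    (EFin \o h') (measurable_rvec k) (@measurable_id _ _ _) (fun _ _ => erefl)
    mEh' Ih').
have Eh : (\int[distribution P Ni]_v (h v)%:E = (mean P (h \o rvec i))%:E)%E.
  rewrite -integral_mean//; apply/esym.
  exact: (eq_law_integral_signed _ _ _ _ _ _ P (distribution P Ni) (rvec i) idfun
    (EFin \o h) (measurable_rvec i) (@measurable_id _ _ _) (fun _ _ => erefl) mEh).
have Eh' : (\int[distribution P Nk]_v (h' v)%:E = (mean P (h' \o rvec k))%:E)%E.
  rewrite -integral_mean//; apply/esym.
  exact: (eq_law_integral_signed _ _ _ _ _ _ P (distribution P Nk) (rvec k) idfun
    (EFin \o h') (measurable_rvec k) (@measurable_id _ _ _) (fun _ _ => erefl) mEh').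
have IF : (distribution P Ni \x distribution P Nk)%E.-integrable setT F.
  apply/integrable12ltyP => //.
  under eq_integral.
    move=> v _; rewrite /F/=.
    under eq_integral do rewrite normrM EFinM.
    rewrite ge0_integralZl//; last by apply/measurable_EFinP; apply: measurableT_comp.
    over.
  move/integrableP : (Qh) => [_ /= hfin]; move/integrableP : (Qh') => [_ /= hfin'].
  rewrite ge0_integralZr//;
    [|by apply/measurable_EFinP; apply: measurableT_comp|exact: integral_ge0].
  by rewrite lte_mul_pinfty// ?integral_ge0// ge0_fin_numE// integral_ge0.
have IX : rintegrable P (fun w => h (rvec i w) * h' (rvec k w)).
  exact: (eq_law_integrable _ _ _ _ _ _ (distribution P Ni \x distribution P Nk)%E P
    idfun X F (@measurable_id _ _ _) mX (fun A mA => esym (XQ A mA)) mF IF).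
split=> //; apply: EFin_inj; rewrite -integral_mean//.
transitivity (\int[distribution P Ni \x distribution P Nk]_z F z)%E.
  exact: (eq_law_integral_signed _ _ _ _ _ _ P (distribution P Ni \x distribution P Nk)%E
    X idfun F mX (@measurable_id _ _ _) XQ mF).
rewrite -integral12_prod_meas1// /fubini_F/F/=.
under eq_integral.
  move=> v _.
  under eq_integral do rewrite EFinM.
  rewrite integralZl// Eh'.
  over.
by rewrite integralZr// Eh EFinM.
Qed.

(** Cameron-Martin for the constant 1 evaluates the integral as [expR (dotv y y / 2)]. *)
Lemma rintegrable_expR_dotv i y : rintegrable P (fun w => expR (dotv (rvec i w) y)).
Proof.
apply/integrableP; split.
  apply/measurable_EFinP; apply: measurableT_comp => //.
  by apply: measurable_dotv; exact: measurable_rvec.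
under eq_integral do rewrite /= ger0_norm ?expR_ge0// -[(expR _)%:E]mul1e.
rewrite -(ge0_cameron_martin i y (fun=> 1%E))//.
under eq_integral do rewrite mul1e.
rewrite integral_cst// lte_mul_pinfty ?lee_fin ?expR_ge0//.
exact: (le_lt_trans (probability_le1 P measurableT) (ltry 1)).
Qed.

(** The Taylor bound [z^4 / 4! <= e^z] for [z >= 0], used at [z = <N, y>] or [z = <N, - y>]
    according to the sign, reduces fourth moments to exponential ones. *)
Lemma rintegrable_dotv4 i y : rintegrable P (fun w => dotv (rvec i w) y ^+ 4).
Proof.
pose e w := 24 * (expR (dotv (rvec i w) y) + expR (dotv (rvec i w) (- y))).
apply: (@le_rintegrable _ _ _ _ _ e).
- by apply: measurable_funX; apply: measurable_dotv; exact: measurable_rvec.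
- move=> w; rewrite /e dotvNr; set x := dotv _ _.
  have bound (z : R) : 0 <= z -> z ^+ 4 <= 24 * expR z.
    by move=> z0; have : 1 + z ^+ 4 / 24 <= expR z := expR_ge1Dxn 3 z0; lra.
  rewrite ger0_norm ?exprn_even_ge0//.
  have := expR_ge0 x; have := expR_ge0 (- x).
  have [x0|x0] := leP 0 x; first by have := bound x x0; lra.
  have := bound (- x); rewrite oppr_ge0 exprNn -signr_odd/= expr0 mul1r => /(_ (ltW x0)).
  lra.
- by apply: rintegrableZ; apply: rintegrableD; exact: rintegrable_expR_dotv.
Qed.

Lemma rintegrable_dotv4_bound i y f (C : R) : measurable_fun setT f ->
  (forall v, `|f v| <= C * (1 + dotv v y ^+ 4)) -> rintegrable P (f \o rvec i).
Proof.
move=> mf fC; apply: (@le_rintegrable _ _ _ _ _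
  (fun w => C * (1 + dotv (rvec i w) y ^+ 4))) => //.
- by apply: measurableT_comp => //; exact: measurable_rvec.
- by move=> w; exact: fC.
- apply: rintegrableZ; apply: rintegrableD; first exact: rintegrable_cst.
  exact: rintegrable_dotv4.
Qed.

Lemma rintegrable_bounded i f (C : R) : measurable_fun setT f ->
  (forall v, `|f v| <= C) -> rintegrable P (f \o rvec i).
Proof.
move=> mf fC; apply: (@le_rintegrable _ _ _ _ _ (fun=> C)) => //.
- by apply: measurableT_comp => //; exact: measurable_rvec.
- by move=> w; exact: fC.
- exact: rintegrable_cst.
Qed.

(** * Consequences of Cameron-Martin for a weight *)

Section weight.
Variable f : V -> R.
Hypothesis mf : measurable_fun setT f.
Hypothesis f0 : forall v, 0 <= f v.

(* Shifted Gaussian laws are equivalent: if [f] vanished almost everywhere it would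
   also vanish at almost all [N + k x], for all [k] at once. *)
Lemma shift_mean_ge0_gt0 i (x : V) :
  (forall v, exists k : nat, 0 < f (v + k%:R *: x)) ->
  rintegrable P (f \o rvec i) -> 0 < mean P (f \o rvec i).
Proof.
move=> fx If; rewrite lt0r (mean_ge0 _ (f \o rvec i))//; last first.
  by move=> w; exact: f0.
rewrite andbT; apply/eqP => Ef0.
have mEf : measurable_fun setT (EFin \o f) by exact/measurable_EFinP.
have fN0 := mean_eq0_ae _ _ If (fun w => f0 (rvec i w)) Ef0.
have fshift0 (k : nat) : {ae P, forall w, f (rvec i w + k%:R *: x) = 0}.
  set y := k%:R *: x.
  have mfy : measurable_fun setT (fun w => f (rvec i w + y)).
    apply: (measurableT_comp mf); apply: (measurableT_comp (measurable_shift y)).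
    exact: measurable_rvec.
  have : (\int[P]_w ((f (rvec i w + y))%:E * (expR (dotv y y / 2))%:E) = 0)%E.
    rewrite (ge0_cameron_martin i y (EFin \o f))//.
    transitivity (\int[P]_w (cst 0%E w))%E; last exact: integral0.
    apply: ae_eq_integral => //.
    - apply: emeasurable_funM; first by apply: (measurableT_comp mEf); exact: measurable_rvec.
      apply/measurable_EFinP; apply: measurableT_comp => //.
      by apply: measurable_dotv; exact: measurable_rvec.
    - by apply: filterS fN0 => w /= fw _; rewrite fw mul0e.
  move=> int0.
  have : ae_eq P setT (fun w => ((f (rvec i w + y))%:E * (expR (dotv y y / 2))%:E)%E) (cst 0%E).
    apply/ae_eq_integral_abs => //.
      by apply: emeasurable_funM => //; exact/measurable_EFinP.
    under eq_integral do rewrite gee0_abs ?mule_ge0 ?lee_fin ?expR_ge0//.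
    exact: int0.
  apply: filterS => w /(_ I)/= [] /eqP.
  by rewrite mulf_eq0 [expR _ == 0]gt_eqF ?expR_gt0// orbF => /eqP.
have /ae_foralln : forall k : nat, {ae P, forall w, f (rvec i w + k%:R *: x) = 0}.
  exact: fshift0.
move=> [A [mA PA0 subA]].
have : (P setT <= P A)%E.
  apply: le_measure; rewrite ?inE// => w _; apply: subA => /= fw.
  by have [k] := fx (rvec i w); rewrite fw ltxx.
by rewrite PA0 probability_setT lee_fin ler10.
Qed.

Hypothesis f1 : forall v, f v <= 1.

Let dotv_bound (v y : V) (z : R) : 0 <= z <= 1 -> `|dotv v y * z| <= 1 * (1 + dotv v y ^+ 4).
Proof.
move=> /andP[z0 z1]; rewrite normrM (ger0_norm z0) mul1r.
apply: (@le_trans _ _ `|dotv v y|); first by rewrite ler_piMr.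
rewrite -(ger0_norm (_ : 0 <= dotv v y ^+ 4)) ?exprn_even_ge0// normrX.
set x := `|dotv v y|; have x0 : 0 <= x by exact: normr_ge0.
have : 0 <= (x ^+ 2 - 1) ^+ 2 by rewrite sqr_ge0.
have : 0 <= (x - 1) ^+ 2 by rewrite sqr_ge0.
by nra.
Qed.

Lemma rintegrable_dotvM i y : rintegrable P (fun w => dotv (rvec i w) y * f (rvec i w)).
Proof.
apply: (@rintegrable_dotv4_bound i y (fun v => dotv v y * f v) 1).
  by apply: measurable_funM => //; exact: measurable_dotv.
by move=> v; apply: dotv_bound; rewrite f0 f1.
Qed.

(* With [F t = E f(N - t y)] and [m = E <N, y> f(N)], Cameron-Martin and
   [1 - t g <= e^(- t g)] give [F 0 - t m <= F t e^(t^2 |y|^2 / 2)]; let [t] tend to 0. *)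
Lemma mean_dotv_ge i (y : V) (c : R) :
  (forall t, 0 < t <= 1 ->
    mean P (fun w => f (rvec i w - t *: y)) <= mean P (f \o rvec i) - c * t) ->
  c <= mean P (fun w => dotv (rvec i w) y * f (rvec i w)).
Proof.
move=> gain; set m := mean _ _.
set A := dotv y y.
have A0 : 0 <= A by exact: dotv_ge0.
have If : rintegrable P (f \o rvec i).
  by apply: (@rintegrable_bounded _ _ 1) => // v; rewrite ger0_norm.
have key t : 0 < t <= 1 -> t * A <= 1 -> c - t * A <= m.
  move=> t01 tA; have /andP[t0 t1] := t01.
  set Ft := mean P (fun w => f (rvec i w - t *: y)).
  have mft : measurable_fun setT (fun v : V => f (v - t *: y)).
    by apply: (measurableT_comp mf); exact: measurable_shift.
  have Ift : rintegrable P (fun w => f (rvec i w - t *: y)).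
    by apply: (@rintegrable_bounded i (fun v => f (v - t *: y)) 1) => // v; rewrite ger0_norm.
  have Ftle1 : Ft <= 1.
    by rewrite -(mean_cst P 1); apply: le_mean => //; exact: rintegrable_cst.
  have Ife : rintegrable P (fun w => f (rvec i w) * expR (dotv (rvec i w) (- (t *: y)))).
    apply: le_rintegrable (rintegrable_expR_dotv i (- (t *: y))).
      apply: measurable_funM; first by apply: (measurableT_comp mf); exact: measurable_rvec.
      apply: measurableT_comp => //.
      by apply: measurable_dotv; exact: measurable_rvec.
    by move=> w; rewrite ger0_norm ?mulr_ge0 ?expR_ge0// ler_piMl ?expR_ge0.
  have CMt : Ft * expR (t ^+ 2 * A / 2) =
      mean P (fun w => f (rvec i w) * expR (dotv (rvec i w) (- (t *: y)))).
    apply: EFin_inj; rewrite -integral_mean// mulrC EFinM -integral_mean//.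
    rewrite -ge0_integralZl//; last 2 first.
    - by apply/measurable_EFinP; exact: rintegrable_measurable Ift.
    - by move=> w _; rewrite lee_fin.
    have := ge0_cameron_martin i (- (t *: y)) (EFin \o f).
    under [in X in _ -> _ -> _ = X]eq_integral do rewrite -EFinM.
    move=> <-//; last exact/measurable_EFinP.
    apply: eq_integral => w _; rewrite muleC; congr (_ * (expR _)%:E)%E.
    by rewrite dotvNl dotvNr opprK dotvZl dotvZr mulrA -expr2.
  have lower : mean P (f \o rvec i) - t * m <= Ft * expR (t ^+ 2 * A / 2).
    rewrite CMt -meanZ; last exact: rintegrable_dotvM.
    rewrite -meanB//; last by apply: rintegrableZ; exact: rintegrable_dotvM.
    apply: le_mean => //.
      by apply: rintegrableB => //; apply: rintegrableZ; exact: rintegrable_dotvM.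
    move=> w /=; rewrite dotvNr dotvZr.
    have := expR_ge1Dx (- (t * dotv (rvec i w) y)); have := f0 (rvec i w).
    set g := dotv _ _; set e := expR _; set a := f _ => a0 /(ler_wpM2l a0); lra.
  have Ft0 : 0 <= Ft by apply: mean_ge0.
  (* With [u = t^2 A / 2 <= 1/2], the inequality [(1 - u) e^u <= 1] yields [e^u <= 2], hence
     [e^u - 1 <= u e^u <= 2 u]. *)
  have eu : expR (t ^+ 2 * A / 2) - 1 <= t ^+ 2 * A.
    set u := t ^+ 2 * A / 2.
    have t2A : t ^+ 2 * A = 2 * u by rewrite /u; field.
    have u0 : 0 <= u.
      by apply: divr_ge0 => //; apply: mulr_ge0 => //; exact: sqr_ge0.
    have u2 : u <= 1 / 2.
      rewrite /u ler_pM2r ?invr_gt0// (le_trans _ tA)// ler_wpM2r//.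
      by rewrite expr2 ler_piMl// ltW.
    have := expR_ge1Dx (- u); rewrite expRN => eu.
    have e0 := expR_gt0 u.
    have : (1 - u) * expR u <= 1.
      by rewrite -[leRHS](mulVf (lt0r_neq0 e0)) ler_wpM2r ?(ltW e0).
    rewrite t2A; set e := expR u in e0 *; nra.
  have := gain t t01; rewrite -/Ft => gt.
  have : Ft * (expR (t ^+ 2 * A / 2) - 1) <= t ^+ 2 * A.
    apply: (le_trans _ eu); rewrite ler_piMl// subr_ge0.
    rewrite -[leLHS]expR0 ler_expR; apply: divr_ge0 => //.
    by apply: mulr_ge0 => //; exact: sqr_ge0.
  rewrite mulrBr mulr1 => upper.
  rewrite -(ler_pM2l t0) mulrBr mulrA -expr2 (mulrC t c); lra.
rewrite leNgt; apply/negP => mc.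
set D := c - m; have D0 : 0 < D by rewrite /D subr_gt0.
(* The first bound ensures both [t <= 1] and [t A <= 1]; the second makes the error [t A] at most
   [D / 2], contradicting [D <= t A]. Using [1 + A] covers [A = 0]. *)
pose t := Num.min (1 + A)^-1 (D / (2 * (1 + A))).
have A1 : 0 < 1 + A by lra.
have t0 : 0 < t by rewrite /t lt_min invr_gt0 A1 divr_gt0// mulr_gt0.
have tA1 : t * (1 + A) <= 1.
  by rewrite -ler_pdivlMr// div1r /t ge_min lexx.
have tAD : t * (1 + A) <= D / 2.
  by rewrite -ler_pdivlMr// -mulrA -invfM /t ge_min lexx orbT.
have tt : 0 <= t * A by rewrite mulr_ge0// ltW.
have := key t; rewrite t0/=.
have -> : t <= 1 by lra.
move=> /(_ isT); have -> : t * A <= 1 by lra.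
by move=> /(_ isT); rewrite /D in tAD; lra.
Qed.

End weight.

(** * Law of large numbers and variance for functions of the observations *)

Section centered.
Variable h : V -> R.
Hypothesis mh : measurable_fun setT h.
Hypothesis Ih : rintegrable P (h \o rvec 0).
Hypothesis Ih2 : rintegrable P (fun w => h (rvec 0 w) ^+ 2).

Let mu := mean P (h \o rvec 0).
Let D i w := h (rvec i w) - mu.
Let hc v := h v - mu.

Let mhc : measurable_fun setT hc.
Proof. exact: measurable_funB. Qed.

Let Ihc : rintegrable P (hc \o rvec 0).
Proof. by apply: rintegrableB => //; exact: rintegrable_cst. Qed.

Let Ehc i : mean P (hc \o rvec i) = 0.
Proof.
rewrite (mean_rvec i 0 hc mhc).
by rewrite [LHS]meanB// ?mean_cst ?subrr//; exact: rintegrable_cst.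
Qed.

Let mhc2 : measurable_fun setT (fun v => hc v * hc v).
Proof. exact: measurable_funM. Qed.

Let Ihc2 : rintegrable P ((fun v => hc v * hc v) \o rvec 0).
Proof.
have -> : (fun v => hc v * hc v) \o rvec 0 =
    (fun w => h (rvec 0 w) ^+ 2 + ((- 2 * mu) * h (rvec 0 w) + mu ^+ 2)).
  by apply/funext => w; rewrite /= /hc; ring.
apply: rintegrableD => //; apply: rintegrableD; last exact: rintegrable_cst.
exact: rintegrableZ.
Qed.

Let ID i k : rintegrable P (fun w => D i w * D k w).
Proof.
have [<-|ik] := eqVneq i k.
  exact: (rintegrable_rvec 0 i _ mhc2).
have Il l : rintegrable P (hc \o rvec l).
  exact: (rintegrable_rvec 0 l _ mhc).
by have [] := mean_indep i k hc hc ik mhc mhc (Il i) (Il k).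
Qed.

Let sg := mean P ((fun v => hc v * hc v) \o rvec 0).

Let D2 i : mean P (fun w => D i w * D i w) <= sg.
Proof. by rewrite /sg -(mean_rvec i 0 _ mhc2). Qed.

Let Dorth i k : i != k -> mean P (fun w => D i w * D k w) = 0.
Proof.
move=> ik.
have Il l : rintegrable P (hc \o rvec l).
  exact: (rintegrable_rvec 0 l _ mhc).
have [_ ->] := mean_indep i k hc hc ik mhc mhc (Il i) (Il k).
by rewrite Ehc mul0r.
Qed.

Let avg_centered M w : (0 < M)%N ->
  M%:R^-1 * (\sum_(i < M) h (rvec i w)) - mu = M%:R^-1 * \sum_(i < M) D i w.
Proof.
move=> M0; rewrite /D sumrB mulrBr; congr (_ - _).
by rewrite sumr_const card_ord -[mu *+ M]mulr_natl mulrA mulVf ?mul1r// pnatr_eq0 -lt0n.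
Qed.

Lemma rvec_slln : {ae P, forall w,
  (fun M => M%:R^-1 * \sum_(i < M) h (rvec i w)) @ \oo --> mu}.
Proof.
have := slln_centered P D sg ID D2 Dorth.
apply: filterS => w Dw.
have DD : (fun M : nat => M%:R^-1 * (\sum_(i < M) D i w) + mu) @ \oo --> mu.
  rewrite -[X in _ --> X]add0r; apply: cvgD => //; exact: cvg_cst.
(* Centering fails at [M = 0], where the average is 0 by convention, so the identity is only
   eventual. *)
have eqM : \forall M \near \oo, M%:R^-1 * (\sum_(i < M) D i w) + mu =
    M%:R^-1 * \sum_(i < M) h (rvec i w).
  by exists 1%N => // M /= M0; rewrite -avg_centered// subrK.
exact: cvg_trans (near_eq_cvg eqM) DD.
Qed.

Lemma rvec_variance : exists2 C : R, 0 <= C & forall M, (0 < M)%N ->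
  rintegrable P (fun w => (M%:R^-1 * (\sum_(i < M) h (rvec i w)) - mu) ^+ 2) /\
  mean P (fun w => (M%:R^-1 * (\sum_(i < M) h (rvec i w)) - mu) ^+ 2) <= M%:R^-1 * C.
Proof.
exists sg; first by apply: mean_ge0 => w; rewrite /= -expr2 sqr_ge0.
move=> M M0.
have -> : (fun w => (M%:R^-1 * (\sum_(i < M) h (rvec i w)) - mu) ^+ 2) =
    (fun w => M%:R^-1 ^+ 2 * (\sum_(i <- index_iota 0 M) D i w) ^+ 2).
  by apply/funext => w; rewrite avg_centered// exprMn big_mkord.
split; first by apply: rintegrableZ; exact: (rintegrable_sum_sqr P D ID).
rewrite meanZ; last exact: (rintegrable_sum_sqr P D ID).
have M0' : 0 < M%:R :> R by rewrite ltr0n.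
have := mean_sum_sqr P D sg ID D2 Dorth 0 M; rewrite subn0 => le.
apply: (le_trans (ler_wpM2l _ le)); first by rewrite exprn_ge0// invr_ge0.
rewrite le_eqVlt; apply/orP; left; apply/eqP.
by set c := sg; field; exact: lt0r_neq0.
Qed.

End centered.

(** * Limits of the estimators *)

Section estimator_limits.
Variable f : V -> R.
Hypothesis mf : measurable_fun setT f.
Hypothesis f0 : forall v, 0 <= f v.
Hypothesis f1 : forall v, f v <= 1.
Let b := mean P (f \o rvec 0).
Hypothesis b0 : 0 < b.
Let a (y : V) := mean P (fun w => dotv (rvec 0 w) y * f (rvec 0 w)).

Let fg (y v : V) := f v * dotv v y.

Let mfg y : measurable_fun setT (fg y).
Proof. by apply: measurable_funM => //; exact: measurable_dotv. Qed.

Let aE y : mean P (fg y \o rvec 0) = a y.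
Proof. by congr mean; apply/funext => w; rewrite /= /fg mulrC. Qed.

Let Ifg y : rintegrable P (fg y \o rvec 0).
Proof.
have -> : fg y \o rvec 0 = (fun w => dotv (rvec 0 w) y * f (rvec 0 w)).
  by apply/funext => w; rewrite /= /fg mulrC.
exact: (rintegrable_dotvM).
Qed.

Let Ifg2 y : rintegrable P (fun w => fg y (rvec 0 w) ^+ 2).
Proof.
apply: (rintegrable_dotv4_bound 0 y (fun v => fg y v ^+ 2) 1).
  exact: measurable_funX.
move=> v; rewrite mul1r ger0_norm ?sqr_ge0// /fg exprMn.
have f2 : f v ^+ 2 <= 1 by rewrite expr_le1.
have g2 : 0 <= dotv v y ^+ 2 by exact: sqr_ge0.
have -> : dotv v y ^+ 4 = (dotv v y ^+ 2) ^+ 2 by rewrite -exprM.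
set z := dotv v y ^+ 2 in g2 *; have : 0 <= (z - 1) ^+ 2 by rewrite sqr_ge0.
have := ler_wpM2r g2 f2; nra.
Qed.

Let If : rintegrable P (f \o rvec 0).
Proof.
by apply: (rintegrable_bounded 0 f 1) => // v; rewrite ger0_norm.
Qed.

Let If2 : rintegrable P (fun w => f (rvec 0 w) ^+ 2).
Proof.
apply: (rintegrable_bounded 0 (fun v => f v ^+ 2) 1).
  exact: measurable_funX.
by move=> v; rewrite ger0_norm ?sqr_ge0// expr_le1.
Qed.

Let Q (y : V) M w := wavg M (fun i => f (rvec i w)) (fun i => dotv (rvec i w) y).

Let mQ y M : measurable_fun setT (Q y M).
Proof.
have mfi i : measurable_fun setT (fun w => f (rvec i w)).
  by apply: (measurableT_comp mf); exact: measurable_rvec.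
apply: measurable_funM.
  apply: measurable_inv_ge0; first by move=> w; apply: sumr_ge0.
  by apply: measurable_sum => i.
apply: measurable_sum => i; apply: measurable_funM => //.
by apply: measurable_dotv; exact: measurable_rvec.
Qed.

Let Ig4 y i : rintegrable P (fun w => dotv (rvec i w) y ^+ 4).
Proof. exact: (rintegrable_dotv4). Qed.

Let IG y M : rintegrable P (fun w => \sum_(i < M) dotv (rvec i w) y ^+ 4).
Proof. by apply: rintegrable_sum => i; exact: Ig4. Qed.

Let IQ y M : rintegrable P (Q y M).
Proof.
(* The bound of [norm_wavg_le] with [s = 1] dominates the quotient whatever its denominator. *)
apply: (@le_rintegrable _ _ _ _ _
  (fun w => 1 + (1 ^+ 3)^-1 * \sum_(i < M) dotv (rvec i w) y ^+ 4)) => //.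
  by move=> w; apply: norm_wavg_le => // i; exact: f0.
by apply: rintegrableD; [exact: rintegrable_cst|apply: rintegrableZ; exact: IG].
Qed.

(** The choice [s = sqrt M] balances all error terms: the variances contribute [s * O(1/M)], the
    fourth moments [s^-3 * M * kappa], and each of these, like [s^-1], is of order [1 / s]. *)
Let mean_Q_dist y : exists2 K : R, 0 <= K & forall M, (0 < M)%N ->
  `|mean P (Q y M) - a y / b| <= K / Num.sqrt M%:R.
Proof.
have [CA CA0 varA] := rvec_variance (fg y) (mfg y) (Ifg y) (Ifg2 y).
have [CB CB0 varB] := rvec_variance f mf If If2.
pose kappa := mean P (fun w => dotv (rvec 0 w) y ^+ 4).
have kappa0 : 0 <= kappa by apply: mean_ge0 => w; rewrite exprn_even_ge0.
have C0 : 0 <= wavg_cst (a y) b.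
  by rewrite /wavg_cst !addr_ge0 ?divr_ge0 ?mulr_ge0 ?addr_ge0 ?divr_ge0 ?exprn_ge0 ?(ltW b0).
exists (wavg_cst (a y) b * (CA + CB + 1 + kappa)).
  by rewrite mulr_ge0// !addr_ge0.
move=> M M0; set s := Num.sqrt M%:R.
have sM : s ^+ 2 = M%:R by rewrite /s sqr_sqrtr.
have s1 : 1 <= s by rewrite /s -[leLHS]sqrtr1 ler_sqrt// ler1n.
have s0 : 0 < s by lra.
have [IA leA] := varA M M0; have [IB leB] := varB M M0.
rewrite aE in IA leA.
set dA := fun w => (M%:R^-1 * (\sum_(i < M) fg y (rvec i w)) - a y) ^+ 2 in IA leA.
set dB := fun w => (M%:R^-1 * (\sum_(i < M) f (rvec i w)) - b) ^+ 2 in IB leB.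
pose G w := \sum_(i < M) dotv (rvec i w) y ^+ 4.
have IE : rintegrable P (fun w => s * dA w + s * dB w + s^-1 + (s ^+ 3)^-1 * G w).
  apply: rintegrableD; last by apply: rintegrableZ; exact: IG.
  apply: rintegrableD; last exact: rintegrable_cst.
  by apply: rintegrableD; exact: rintegrableZ.
have meanG : mean P G = M%:R * kappa.
  rewrite mean_sum//; transitivity (\sum_(i < M) kappa); last first.
    by rewrite sumr_const card_ord [RHS]mulr_natl.
  apply: eq_bigr => i _.
  rewrite (mean_rvec i 0 (fun v => dotv v y ^+ 4))//.
  by apply: measurable_funX; exact: measurable_dotv.
have IQc : rintegrable P (fun w => Q y M w - a y / b).
  by apply: rintegrableB => //; exact: rintegrable_cst.
have -> : mean P (Q y M) - a y / b = mean P (fun w => Q y M w - a y / b).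
  by rewrite meanB// ?mean_cst//; exact: rintegrable_cst.
apply: (le_trans (norm_mean _ _ IQc)).
apply: (@le_trans _ _ (mean P (fun w => wavg_cst (a y) b *
    (s * dA w + s * dB w + s^-1 + (s ^+ 3)^-1 * G w)))).
  apply: le_mean; first exact: rintegrable_norm.
    exact: rintegrableZ.
  by move=> w; apply: dist_wavg_le => // i; exact: f0.
rewrite meanZ// -mulrA ler_wpM2l//.
rewrite meanD; last 2 first.
- apply: rintegrableD; last exact: rintegrable_cst.
  by apply: rintegrableD; exact: rintegrableZ.
- by apply: rintegrableZ; exact: IG.
rewrite meanD; last 2 first.
- by apply: rintegrableD; exact: rintegrableZ.
- exact: rintegrable_cst.
rewrite meanD; last 2 first.
- exact: rintegrableZ.
- exact: rintegrableZ.
rewrite mean_cst !meanZ//; last exact: IG.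
rewrite meanG -sM.
have -> : (s ^+ 3)^-1 * (s ^+ 2 * kappa) = kappa / s.
  by field; exact: lt0r_neq0.
have scale (E C : R) : E <= M%:R^-1 * C -> s * E <= C / s.
  move=> EC; apply: (le_trans (ler_wpM2l (ltW s0) EC)); rewrite -sM.
  rewrite le_eqVlt; apply/orP; left; apply/eqP.
  by field; exact: lt0r_neq0.
rewrite !mulrDl mul1r lerD2r lerD2r; apply: lerD; exact: scale.
Qed.

Lemma westimator_mean_cvg (y : V) :
  (fun M => (\int[P]_w (dotv (westimator f M (rvec ^~ w)) y)%:E)%E) @ \oo
    --> (a y / b)%:E.
Proof.
have [K K0 dist] := mean_Q_dist y.
have -> : (fun M => (\int[P]_w (dotv (westimator f M (rvec ^~ w)) y)%:E)%E) =
    (fun M => (mean P (Q y M))%:E).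
  apply/funext => M; rewrite -integral_mean//.
  by apply: eq_integral => w _; rewrite dotv_westimator.
apply: cvg_EFin; first by near=> M.
apply/cvgrPdist_le => e e0.
near=> M.
have M0 : (0 < M)%N by near: M; exists 1%N.
rewrite distrC; apply: (le_trans (dist M M0)).
have s0 : 0 < Num.sqrt M%:R :> R by rewrite sqrtr_gt0 ltr0n.
rewrite ler_pdivrMr// -(@ler_pXn2r _ 2)// ?nnegrE ?mulr_ge0 ?(ltW e0)//.
rewrite exprMn sqr_sqrtr// mulrC -ler_pdivrMr ?exprn_gt0//.
near: M; exact: nbhs_infty_ger.
Unshelve. all: by end_near. Qed.

(** The limit [v] has coordinates [a (delta_mx 0 j) / b], so [<v, x> = a x / b > 0] by linearity:
    positive correlation with one vector already excludes [v = 0]. *)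
Lemma westimator_ae_cvg (x : V) : 0 < a x ->
  {ae P, forall w, exists v : V, v != 0 /\
    (fun M => westimator f M (rvec ^~ w)) @ \oo --> v}.
Proof.
move=> ax; pose v : V := \sum_(j < d) (a (delta_mx 0 j) / b) *: delta_mx 0 j.
have axE : a x = \sum_(j < d) x 0 j * a (delta_mx 0 j).
  rewrite /a -[LHS]aE {1}(row_sum_delta x).
  transitivity (mean P (fun w => \sum_(j < d) x 0 j * fg (delta_mx 0 j) (rvec 0 w))).
    congr mean; apply/funext => w; rewrite /= /fg dotvC dotv_suml mulr_sumr.
    by apply: eq_bigr => j _; rewrite dotvZl dotvC mulrCA.
  rewrite mean_sum => [|j]; last by apply: rintegrableZ; exact: Ifg.
  by apply: eq_bigr => j _; rewrite meanZ ?aE//; exact: Ifg.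
have v0 : v != 0.
  have : dotv v x = a x / b.
    rewrite dotv_suml axE mulr_suml; apply: eq_bigr => j _.
    by rewrite dotvZl dotvC dotv_delta mulrC mulrA.
  by apply: contra_eq_neq => ->; rewrite dotv0l lt_eqF// divr_gt0.
have sllnf := rvec_slln f mf If If2.
have sllng : {ae P, forall w, forall j : 'I_d,
    (fun M => M%:R^-1 * \sum_(i < M) fg (delta_mx 0 j) (rvec i w)) @ \oo -->
      a (delta_mx 0 j)}.
  apply: filter_forall => j.
  have := rvec_slln _ (mfg (delta_mx 0 j)) (Ifg _) (Ifg2 _).
  by rewrite aE.
apply: filterS2 sllnf sllng => w cf cg; exists v; split => //.
have estE : (fun M => westimator f M (rvec ^~ w)) =
    (fun M => \sum_(j < d) ((M%:R^-1 * \sum_(i < M) fg (delta_mx 0 j) (rvec i w)) *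
      (M%:R^-1 * \sum_(i < M) f (rvec i w))^-1) *: (delta_mx 0 j : V)).
  apply/funext => M; rewrite [LHS]row_sum_delta; apply: eq_bigr => j _; congr (_ *: _).
  rewrite -dotv_delta dotv_westimator /wavg.
  have [->|M0] := posnP M; first by rewrite !big_ord0 !mulr0 mul0r.
  by rewrite invfM invrK mulrACA mulVf ?mul1r 1?mulrC// pnatr_eq0 -lt0n.
rewrite estE; apply: cvg_big => [|j _]; first exact: add_continuous.
apply: cvgZr_tmp.
by apply: cvgM => //; apply: cvgV => //; exact: lt0r_neq0.
Qed.

End estimator_limits.

(** * Positive correlation and separation for the two weights *)

Section correlation.
Variables (L : nat) (x : 'I_L -> 'rV[R]_d).
Hypothesis L2 : (2 <= L)%N.
Hypothesis xinj : injective x.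
Hypothesis xnorm : forall l k : 'I_L, enorm (x l) = enorm (x k).

Lemma mean_hard_weight_gt0 l : 0 < mean P (hard_weight x l \o rvec 0).
Proof.
apply: (shift_mean_ge0_gt0 _ (measurable_hard_weight x l) _ 0 (x l)).
- exact: hard_weight_ge0.
- move=> v; have [k kP] := template_shift_lt x xinj xnorm l v.
  by exists k; exact: hard_weight_gt0.
apply: (rintegrable_bounded 0 _ 1); first exact: measurable_hard_weight.
by move=> v; rewrite ger0_norm ?hard_weight_ge0 ?hard_weight_le1.
Qed.

Let a l (y : 'rV[R]_d) := mean P (fun w => dotv (rvec 0 w) y * hard_weight x l (rvec 0 w)).

Let Ia l y : rintegrable P (fun w => dotv (rvec 0 w) y * hard_weight x l (rvec 0 w)).
Proof.
apply: (rintegrable_dotvM).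
- exact: measurable_hard_weight.
- exact: hard_weight_ge0.
- exact: hard_weight_le1.
Qed.

Let aD l y z : a l (y + z) = a l y + a l z.
Proof.
rewrite /a -meanD//; congr mean; apply/funext => w.
by rewrite dotvDr mulrDl.
Qed.

Let aZ l c y : a l (c *: y) = c * a l y.
Proof.
rewrite /a -meanZ//; congr mean; apply/funext => w.
by rewrite dotvZr mulrA.
Qed.

Let aB l y z : a l (y - z) = a l y - a l z.
Proof. by rewrite aD; congr (_ + _); rewrite -scaleN1r aZ mulN1r. Qed.

(** On the cell of [l], [<v, x_l - x_k>] is nonnegative, and it becomes positive after a large shift
    along [x_l]; the shift criterion then gives a positive mean. *)
Lemma hard_weight_separation l k : k != l -> a l (x k) < a l (x l).
Proof.
move=> kl; rewrite -subr_gt0.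
have -> : a l (x l) - a l (x k) = a l (x l - x k).
  by rewrite aB.
rewrite /a.
apply: (shift_mean_ge0_gt0 
  (fun v => dotv v (x l - x k) * hard_weight x l v) _ _ 0 (x l)); last exact: Ia.
- by apply: measurable_funM; [exact: measurable_dotv|exact: measurable_hard_weight].
- move=> v; rewrite /hard_weight; case: forallP => [le|_]; last by rewrite mulr0.
  by rewrite mulr1 dotvBr subr_ge0.
- move=> v; have [K KP] := template_shift_lt x xinj xnorm l v.
  exists K; rewrite mulr_gt0 ?hard_weight_gt0//.
  by rewrite dotvBr subr_gt0 KP.
Qed.

Lemma hard_weight_correlation l : 0 < a l (x l).
Proof.
have [k kl] := exists_ord_neq _ l L2.
have [K KP] := template_shift_lt x xinj xnorm l (- (x l - x k)).
set z := _ + _ in KP.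
(* [z = K x_l - (x_l - x_k)] lies in the convex cone on which the weight is 1. *)
have az : 0 <= a l z.
  apply: (mean_dotv_ge _ (measurable_hard_weight x l)).
  - exact: hard_weight_ge0.
  - exact: hard_weight_le1.
  (* The rate is [c = 0]: if [v - t z] lies in the cell then so does [v = (v - t z) + t z], the cell
     being stable under addition and positive scaling. *)
  move=> t /andP[t0 _]; rewrite mul0r subr0; apply: le_mean.
  - apply: (rintegrable_bounded 0 (fun v => hard_weight x l (v - t *: z)) 1).
      by apply: (measurableT_comp (measurable_hard_weight x l)); exact: measurable_shift.
    by move=> v; rewrite ger0_norm ?hard_weight_ge0 ?hard_weight_le1.
  - apply: (rintegrable_bounded 0 _ 1); first exact: measurable_hard_weight.
    by move=> v; rewrite ger0_norm ?hard_weight_ge0 ?hard_weight_le1.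
  - move=> w; rewrite /= {1}/hard_weight; case: forallP => [le|_]; last exact: hard_weight_ge0.
    rewrite /hard_weight; have -> // : [forall r, dotv (rvec 0 w) (x r) <= dotv (rvec 0 w) (x l)].
    apply/forallP => r; have [->//|rl] := eqVneq r l.
    have := le r; rewrite !dotvBl !dotvZl.
    have := ltW (KP r rl); move=> /(ler_wpM2l (ltW t0)); lra.
have : 0 < K%:R * a l (x l).
  have -> : K%:R * a l (x l) = a l z + (a l (x l) - a l (x k)).
    by rewrite /z aD aZ opprB !aB; ring.
  by have := hard_weight_separation l k kl; lra.
have K0 : 0 <= K%:R :> R by [].
(* Positivity of the product suffices: a nonpositive [a l (x l)] would make it nonpositive, so
   [K > 0] is never shown separately. *)
by move=> Ka; rewrite ltNge; apply/negP => a0; have := ler_wpM2l K0 a0; rewrite mulr0; lra.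
Qed.

Lemma mean_soft_weight_gt0 l : 0 < mean P ((soft_weight x)^~ l \o rvec 0).
Proof.
(* The softmax weight is positive everywhere, so the zero shift is enough. *)
apply: (shift_mean_ge0_gt0 _ (measurable_soft_weight x l) _ 0 0).
- by move=> v; rewrite ltW// soft_weight_gt0.
- by move=> v; exists 0%N; exact: soft_weight_gt0.
apply: (rintegrable_bounded 0 _ 1); first exact: measurable_soft_weight.
by move=> v; rewrite ger0_norm ?soft_weight_le1// ltW// soft_weight_gt0.
Qed.

(** Averaging the pointwise decrease gives the rate [delta / (1 + delta) * E[p (1 - p)]], with [p]
    the softmax weight of [l]. It is positive because [0 < p < 1], the upper bound coming from the
    presence of a second template. *)
Lemma soft_weight_correlation l :
  0 < mean P (fun w => dotv (rvec 0 w) (x l) * soft_weight x (rvec 0 w) l).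
Proof.
have [delta d0 gap] := template_gap x xinj xnorm l.
pose f v := soft_weight x v l.
have mf : measurable_fun setT f by exact: measurable_soft_weight.
have f0 v : 0 < f v by exact: soft_weight_gt0.
have f1 v : f v < 1 by exact: soft_weight_lt1.
have mff : measurable_fun setT (fun v => f v * (1 - f v)).
  by apply: measurable_funM => //; exact: measurable_funB.
have ff0 v : 0 < f v * (1 - f v) by rewrite mulr_gt0// subr_gt0.
have Iff : rintegrable P ((fun v => f v * (1 - f v)) \o rvec 0).
  apply: (rintegrable_bounded 0 _ 1) => // v.
  rewrite ger0_norm; last exact: ltW.
  by have := f0 v; have := f1 v; nra.
have If : rintegrable P (f \o rvec 0).
  by apply: (rintegrable_bounded 0 _ 1) => // v; rewrite ger0_norm ltW.
set m := mean P ((fun v => f v * (1 - f v)) \o rvec 0).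
have m0 : 0 < m.
  apply: (shift_mean_ge0_gt0 _ mff _ 0 0) => //.
    by move=> v; exact: ltW.
  by move=> v; exists 0%N; exact: ff0.
apply: (@lt_le_trans _ _ (delta / (1 + delta) * m)).
  by rewrite mulr_gt0// divr_gt0//; lra.
apply: (mean_dotv_ge f mf) => [v|v|t t01].
- exact: ltW.
- exact: ltW.
rewrite -mulrA (mulrC m) mulrA -meanZ// -meanB//; last exact: rintegrableZ.
apply: le_mean.
- apply: (rintegrable_bounded 0 (fun v => f (v - t *: x l)) 1).
    by apply: (measurableT_comp mf); exact: measurable_shift.
  by move=> v; rewrite ger0_norm ltW.
- by apply: rintegrableB => //; exact: rintegrableZ.
- by move=> w; exact: soft_weight_shift.
Qed.

Lemma hard_est_ae_cvg l : {ae P, forall w, exists v : V, v != 0 /\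
  (fun M => hard_est x M (rvec ^~ w) l) @ \oo --> v}.
Proof.
have := westimator_ae_cvg _ (measurable_hard_weight x l) (hard_weight_ge0 x l)
  (hard_weight_le1 x l) (mean_hard_weight_gt0 l) (x l) (hard_weight_correlation l).
apply: filterS => w [v [v0 cv]]; exists v; split => //.
by under eq_fun do rewrite hard_estE; exact: cv.
Qed.

Lemma hard_est_mean_cvg l y :
  (fun M => (\int[P]_w (dotv (hard_est x M (rvec ^~ w) l) y)%:E)%E) @ \oo -->
  (mean P (fun w => dotv (rvec 0 w) y * hard_weight x l (rvec 0 w)) /
   mean P (hard_weight x l \o rvec 0))%:E.
Proof.
have -> : (fun M => (\int[P]_w (dotv (hard_est x M (rvec ^~ w) l) y)%:E)%E) =
    (fun M => (\int[P]_w (dotv (westimator (hard_weight x l) M (rvec ^~ w)) y)%:E)%E).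
  by apply/funext => M; apply: eq_integral => w _; rewrite hard_estE.
exact: (westimator_mean_cvg _ (measurable_hard_weight x l) (hard_weight_ge0 x l)
  (hard_weight_le1 x l) (mean_hard_weight_gt0 l)).
Qed.

Lemma soft_est_ae_cvg l : {ae P, forall w, exists v : V, v != 0 /\
  (fun M => soft_est x M (rvec ^~ w) l) @ \oo --> v}.
Proof.
exact: (westimator_ae_cvg _ (measurable_soft_weight x l)
  (fun v => ltW (soft_weight_gt0 x l v)) (soft_weight_le1 x l)
  (mean_soft_weight_gt0 l) (x l) (soft_weight_correlation l)).
Qed.

Lemma soft_est_mean_cvg l y :
  (fun M => (\int[P]_w (dotv (soft_est x M (rvec ^~ w) l) y)%:E)%E) @ \oo -->
  (mean P (fun w => dotv (rvec 0 w) y * soft_weight x (rvec 0 w) l) /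
   mean P ((soft_weight x)^~ l \o rvec 0))%:E.
Proof.
exact: (westimator_mean_cvg _ (measurable_soft_weight x l)
  (fun v => ltW (soft_weight_gt0 x l v)) (soft_weight_le1 x l) (mean_soft_weight_gt0 l)).
Qed.

Lemma est_limits (est : nat -> (nat -> V) -> 'I_L -> V) :
  est = hard_est x \/ est = soft_est x ->
  (forall l, {ae P, forall w, exists v : V, v != 0 /\
    (fun M => est M (rvec ^~ w) l) @ \oo --> v}) /\
  (forall l, exists c : R, 0 < c /\
    (fun M => (\int[P]_w (dotv (est M (rvec ^~ w) l) (x l))%:E)%E) @ \oo --> c%:E).
Proof.
case=> ->; split=> l.
- exact: hard_est_ae_cvg.
- eexists; split; last exact: hard_est_mean_cvg.
  by apply: divr_gt0; [exact: hard_weight_correlation|exact: mean_hard_weight_gt0].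
- exact: soft_est_ae_cvg.
- eexists; split; last exact: soft_est_mean_cvg.
  by apply: divr_gt0; [exact: soft_weight_correlation|exact: mean_soft_weight_gt0].
Qed.

Lemma hard_est_consistent l k : k != l -> exists a b : R, b < a /\
  (fun M => (\int[P]_w (dotv (hard_est x M (rvec ^~ w) l) (x l))%:E)%E) @ \oo
    --> a%:E /\
  (fun M => (\int[P]_w (dotv (hard_est x M (rvec ^~ w) l) (x k))%:E)%E) @ \oo
    --> b%:E.
Proof.
move=> kl; do 2 eexists; split; last by split; exact: hard_est_mean_cvg.
rewrite ltr_pM2r ?invr_gt0; first exact: hard_weight_separation.
exact: mean_hard_weight_gt0.
Qed.

End correlation.

End gaussian_vectors.

Theorem theorem1 (R : realType) (dT : measure_display) (T : measurableType dT)
  (P : probability T R) (L d : nat) (x : 'I_L -> 'rV[R]_d)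
  (n : nat -> 'I_d -> T -> R) :
  (2 <= L)%N -> (1 <= d)%N ->
  injective x ->
  (forall l k : 'I_L, enorm (x l) = enorm (x k)) ->
  (forall i j, measurable_fun setT (n i j)) ->
  (forall i j (B : set R), measurable B ->
      P (n i j @^-1` B) = normal_prob 0 1 B) ->
  mutually_independent P (fun ij : nat * 'I_d => n ij.1 ij.2) ->
  let nn (w : T) (i : nat) : 'rV[R]_d := \row_(j < d) n i j w in
  (forall est : nat -> (nat -> 'rV[R]_d) -> 'I_L -> 'rV[R]_d,
     est = hard_est x \/ est = soft_est x ->
     (forall l : 'I_L, {ae P, forall w,
        exists v : 'rV[R]_d, v != 0 /\
          (fun M => est M (nn w) l) @ \oo --> v}) /\
     (forall l : 'I_L, exists c : R, 0 < c /\
        (fun M => (\int[P]_w (dotv (est M (nn w) l) (x l))%:E)%E) @ \oo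
          --> c%:E)) /\
  (forall l k : 'I_L, k != l ->
     exists a b : R, b < a /\
       (fun M => (\int[P]_w (dotv (hard_est x M (nn w) l) (x l))%:E)%E) @ \oo
          --> a%:E /\
       (fun M => (\int[P]_w (dotv (hard_est x M (nn w) l) (x k))%:E)%E) @ \oo
          --> b%:E).
Proof.
move=> L2 _ xinj xnorm mn n01 n_indep nn; split=> [est|l k].
  exact: (est_limits P d n mn n01 n_indep L x L2 xinj xnorm).
exact: (hard_est_consistent P d n mn n01 n_indep L x xinj xnorm).
Qed.
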